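(* Let $k\ge 2$, $1\le m<k$, and for each alternative $\ell\in\{1,\dots,k\}$ let $X_{\ell,1},X_{\ell,2},\dots$ be i.i.d. real random variables with mean $\mu_\ell$, independent across alternatives, with the means pairwise distinct and ordered as $\mu_{\langle 1\rangle}>\mu_{\langle 2\rangle}>\dots>\mu_{\langle k\rangle}$. Suppose Assumptions 1–4 of the context hold. Let $r_{\langle 1\rangle},\dots,r_{\langle k\rangle}>0$ with $\sum_\ell r_{\langle\ell\rangle}=1$, and for $T>0$ let $\mathrm{PFS}_T=\Pr\Big\{\bigcup_{i=1}^m\bigcup_{j=m+1}^k\big(\bar X_{\langle i\rangle}(r_{\langle i\rangle}T)\le \bar X_{\langle j\rangle}(r_{\langle j\rangle}T)\big)\Big\}$. Then $-\lim_{T\to\infty}\frac1T\log\mathrm{PFS}_T=\min_{i\in\{1,\dots,m\},\,j\in\{m+1,\dots,k\}}G_{ij}(r_{\langle i\rangle},r_{\langle j\rangle})$, where $G_{ij}(r_{\langle i\rangle},r_{\langle j\rangle})=\inf_{x\in\mathbb R}\big(r_{\langle i\rangle}\Lambda^*_{\langle i\rangle}(x)+r_{\langle j\rangle}\Lambda^*_{\langle j\rangle}(x)\big)$.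
   Context: $\bar X_\ell(n)$ denotes the sample mean of the first $n$ replications of alternative $\ell$ (integrality of $r_\ell T$ is ignored). Let $\Lambda^{(n)}_\ell(\lambda)=\log\mathbb E[e^{\lambda\bar X_\ell(n)}]$. Assumption 1: for each $\ell$ and all $\lambda\in\mathbb R$ the limit $\Lambda_\ell(\lambda)=\lim_{n\to\infty}\frac1n\Lambda^{(n)}_\ell(n\lambda)$ exists as an extended real number. Let $\mathcal D_{\Lambda_\ell}=\{\lambda:\Lambda_\ell(\lambda)<\infty\}$ with interior $\mathcal D^o_{\Lambda_\ell}$, and $\mathcal F_\ell=\{\Lambda_\ell'(\lambda):\lambda\in\mathcal D^o_{\Lambda_\ell}\}$ with interior $\mathcal F^o_\ell$. Assumption 2: $0\in\mathcal D^o_{\Lambda_\ell}$ for all $\ell$. Assumption 3: each $\Lambda_\ell$ is strictly convex and continuous on $\mathcal D^o_{\Lambda_\ell}$ and steep, i.e. $|\Lambda_\ell'(\lambda_n)|\to\infty$ for every sequence $\lambda_n\in\mathcal D^o_{\Lambda_\ell}$ converging to a boundary point of $\mathcal D^o_{\Lambda_\ell}$. Assumption 4: $[\mu_{\langle k\rangle},\mu_{\langle 1\rangle}]\subset\bigcap_{\ell=1}^k\mathcal F^o_\ell$. $\Lambda^*_\ell(x)=\sup_{\lambda\in\mathbb R}\{\lambda x-\Lambda_\ell(\lambda)\}$ is the Fenchel–Legendre transform. *)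

(* Defs.v *)
From HB Require Import structures.
From mathcomp Require Import all_boot all_order all_algebra.
From mathcomp Require Import all_classical all_reals all_analysis.
Set Implicit Arguments.
Unset Strict Implicit.
Unset Printing Implicit Defensive.
Import Order.TTheory GRing.Theory Num.Theory Num.Def.
Import numFieldNormedType.Exports.
Local Open Scope classical_set_scope.
Local Open Scope ring_scope.

Section Defs.
Context {d : measure_display} {T : measurableType d} {R : realType}.

Definition mutually_independent (P : probability T R) {I : eqType}
    (X : I -> {RV P >-> R}) : Prop :=
  forall (S : seq I) (B : I -> set R), uniq S ->
    (forall i, i \in S -> measurable (B i)) ->
    P (\bigcap_(i in [set` S]) (X i @^-1` B i)) =
    (\prod_(i <- S) P (X i @^-1` B i))%E.

Definition sample_mean (Y : nat -> T -> R) (n : nat) : T -> R :=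
  fun w => (\sum_(i < n) Y i w) / n%:R.

Definition log_mgf (P : probability T R) (Z : T -> R) (t : R) : \bar R :=
  let M := (\int[P]_w (expR (t * Z w))%:E)%E in
  if M == +oo%E then +oo%E else (ln (fine M))%:E.

End Defs.

Section Rdefs.
Context {R : realType}.

Definition eff_dom (L : R -> \bar R) : set R := [set t | (L t < +oo)%E].

(** Lambda viewed as a real function (it is finite on the interior of its
    effective domain, which is where it is used). *)
Definition real_part (L : R -> \bar R) : R -> R := fun t => fine (L t).

Definition deriv_range (L : R -> \bar R) : set R :=
  [set derive1 (real_part L) t | t in interior (eff_dom L)].

Definition FL_transform (L : R -> \bar R) (x : R) : \bar R :=
  ereal_sup (range (fun t => ((t * x)%:E - L t)%E)).

End Rdefs.

(* Main.v *)
(** Since the samples are i.i.d., [Lam l] is the logarithm of the moment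
    generating function of [X l 0]. The event attached to a pair (i, j) is
    [0 <= Z], where Z is t times the difference of the two sample means, and
    log E e^(sZ) / t converges to H s = r_j L_j (s / r_j) + r_i L_i (- s / r_i).
    Here H'(0) = mu_j - mu_i < 0, while Assumption 4 provides a point where
    H' >= 0, so H' vanishes at some th >= 0. There the two derivatives
    L_j'(th / r_j) and L_i'(- th / r_i) agree; at this common value the
    Fenchel-Young inequalities are equalities, whence G i j = - H th.
    Chernoff's bound at th is the upper bound. The lower bound needs no change
    of measure: for s = th + h, the parts of E e^(sZ) where Z < 0 and where
    Z > ct are at most E e^(th Z) and e^(-hct) E e^((th + 2h)Z), and both are
    exponentially smaller than E e^(sZ) because H th < H (th + h) by strict
    convexity and H (th + 2h) - H (th + h) < hc by H'(th) = 0. What remains is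
    at most e^(sct) P(0 <= Z). *)

Require Import Defs.
From HB Require Import structures.
From mathcomp Require Import all_boot all_order all_algebra.
From mathcomp Require Import all_classical all_reals all_analysis.
From mathcomp Require Import measurable_realfun perm ring lra.
Set Implicit Arguments.
Unset Strict Implicit.
Import Order.TTheory GRing.Theory Num.Theory Num.Def.
Import numFieldNormedType.Exports.
Import HBNNSimple.
Local Open Scope classical_set_scope.
Local Open Scope ring_scope.

(** * Independence: integrals of products of nonnegative functions *)

(** The hypothesis on indicators passes to simple functions by linearity and to [f] by monotone
    convergence along [nnsfun_approx]. In the application [g] is the product of the remaining
    factors and [c] the product of their integrals. *)
Lemma ge0_indep_integralM d (T : measurableType d) (R : realType)
    (P : probability T R) (X : {RV P >-> R}) (g : T -> R) (c : \bar R) (f : R -> R) :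
  measurable_fun setT g -> (forall w, 0 <= g w) ->
  measurable_fun setT f -> (forall x, 0 <= f x) -> (0 <= c)%E ->
  (forall B, measurable B ->
    (\int[P]_w (g w * \1_(X @^-1` B) w)%:E = c * P (X @^-1` B))%E) ->
  (\int[P]_w (g w * f (X w))%:E = c * \int[P]_w (f (X w))%:E)%E.
Proof.
move=> mg g0 mf f0 c0 hB.
have mX : measurable_fun setT X by [].
have mXB B : measurable B -> measurable (X @^-1` B).
  by move=> mB; rewrite -[_ @^-1` _]setTI; exact: mX.
have hs (h : {nnsfun R >-> R}) :
    (\int[P]_w (g w * h (X w))%:E = c * \int[P]_w (h (X w))%:E)%E.
  (* The coefficient is [|y|] so that every summand is nonnegative for all real [y], as the exchange
     of sum and integral asks. *)
  have hE x : h x = \sum_(y \in range h) `|y| * \1_(h @^-1` [set y]) x.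
    rewrite {1}fimfunE; apply: eq_fsbigr => y; rewrite inE => -[z _ <-].
    by rewrite ger0_norm.
  have mhy y : measurable (X @^-1` (h @^-1` [set y])).
    by apply: mXB; rewrite -[_ @^-1` _]setTI; exact: measurable_funPT.
  have m1 y : measurable_fun [set: T]
      (fun w => (g w * \1_(X @^-1` (h @^-1` [set y])) w)%:E : \bar R).
    apply/measurable_EFinP; apply: measurable_funM => //.
  have m2 y : measurable_fun [set: T]
      (fun w => (\1_(X @^-1` (h @^-1` [set y])) w)%:E : \bar R).
    by apply/measurable_EFinP; apply: measurable_indic.
  transitivity (\int[P]_w (\sum_(y \in range h)
      `|y|%:E * (g w * \1_(X @^-1` (h @^-1` [set y])) w)%:E)%E)%E.
    apply: eq_integral => w _.
    rewrite hE fsumEFin; last by [].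
    rewrite mulr_fsumr//; congr EFin; apply: eq_fsbigr => y _.
    rewrite mulrCA; congr (_ * (_ * _)).
  rewrite ge0_integral_fsum//; [|by move=> y; apply: measurable_funeM|
    by move=> y w _; rewrite mule_ge0// lee_fin mulr_ge0].
  transitivity (c * \int[P]_w (\sum_(y \in range h)
      `|y|%:E * (\1_(X @^-1` (h @^-1` [set y])) w)%:E)%E)%E; last first.
    congr (c * _)%E; apply: eq_integral => w _.
    by rewrite hE fsumEFin.
  rewrite ge0_integral_fsum//; [|by move=> y; apply: measurable_funeM].
  rewrite ge0_mule_fsumr; last first.
    by move=> y; apply: integral_ge0 => w _; rewrite mule_ge0.
  apply: eq_fsbigr => y _.
  rewrite ge0_integralZl//; last by move=> w _; rewrite lee_fin mulr_ge0.
  rewrite ge0_integralZl// hB; last first.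
    by rewrite -[_ @^-1` _]setTI; exact: measurable_funPT.
  by rewrite integral_indic// setIT muleCA.
have mEf : measurable_fun setT (EFin \o f) by exact/measurable_EFinP.
pose h := nnsfun_approx measurableT mEf.
have hcvg x : (EFin \o h^~ x) n @[n --> \oo] --> (f x)%:E.
  by apply: (cvg_nnsfun_approx measurableT mEf) => // y _; rewrite lee_fin.
have hnd x : {homo h^~ x : n m / (n <= m)%N >-> n <= m}.
  by move=> n m nm; have /lefP/(_ x) := nd_nnsfun_approx measurableT mEf nm.
have mhX n : measurable_fun setT (fun w => h n (X w)).
  by apply: measurableT_comp.
have cvgL : (\int[P]_w (g w * h n (X w))%:E)%E @[n --> \oo] -->
    (\int[P]_w (g w * f (X w))%:E)%E.
  have -> : (\int[P]_w (g w * f (X w))%:E)%E =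
      (\int[P]_w (limn (fun n => (g w * h n (X w))%:E)))%E.
    apply: eq_integral => w _; apply/esym/cvg_lim => //.
    under eq_fun do rewrite EFinM.
    by rewrite EFinM; apply: cvgeZl => //; exact: hcvg.
  apply: cvg_monotone_convergence => //.
  - by move=> n; apply/measurable_EFinP; apply: measurable_funM.
  - by move=> n w _; rewrite lee_fin mulr_ge0.
  - by move=> w _ n m nm; rewrite lee_fin ler_wpM2l// hnd.
have cvgR : (\int[P]_w (h n (X w))%:E)%E @[n --> \oo] -->
    (\int[P]_w (f (X w))%:E)%E.
  have -> : (\int[P]_w (f (X w))%:E)%E =
      (\int[P]_w (limn (fun n => (h n (X w))%:E)))%E.
    by apply: eq_integral => w _; apply/esym/cvg_lim => //; exact: hcvg.
  apply: cvg_monotone_convergence => //.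
  - by move=> n; apply/measurable_EFinP.
  - by move=> n w _; rewrite lee_fin.
  - by move=> w _ n m nm; rewrite lee_fin hnd.
suff cvgRc : (\int[P]_w (g w * h n (X w))%:E)%E @[n --> \oo] -->
    (c * \int[P]_w (f (X w))%:E)%E by exact: (cvg_unique _ cvgL cvgRc).
under eq_fun do rewrite hs.
(* [c] may be [+oo], and multiplication by [+oo] is not continuous at 0; when the limit is 0 every
   approximating integral is already 0. *)
have [f00|fn0] := eqVneq (\int[P]_w (f (X w))%:E)%E 0%E.
  rewrite f00 mule0.
  have hn0 n : (\int[P]_w (h n (X w))%:E)%E = 0%E.
    apply/eqP; rewrite eq_le; apply/andP; split; last first.
      by apply: integral_ge0 => w _; rewrite lee_fin.
    rewrite -f00; apply: ge0_le_integral => //.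
    - by move=> w _; rewrite lee_fin.
    - exact/measurable_EFinP.
    - by apply/measurable_EFinP; apply: measurableT_comp.
    - move=> w _; pose u := fun n => (h n (X w))%:E.
      have und : {homo u : a b / (a <= b)%N >-> (a <= b)%E}.
        by move=> a b ab; rewrite lee_fin hnd.
      have uf : u n @[n --> \oo] --> (f (X w))%:E by exact: hcvg.
      rewrite (cvg_unique _ uf (ereal_nondecreasing_cvgn und))//.
      by apply: ereal_sup_ubound; exists n.
  under eq_fun do rewrite hn0 mule0.
  exact: cvg_cst.
have [cfin|] := boolP (c \is a fin_num); first exact: cvgeZl.
case: c c0 {hB hs cvgL} => // _ _.
apply: cvgeM => //; last exact: cvg_cst.
by rewrite /mule_def; case: (\int[P]_w (f (X w))%:E)%E fn0.
Qed.

Lemma indep_integral_prod d (T : measurableType d) (R : realType)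
    (P : probability T R) (I : choiceType) (X : I -> {RV P >-> R}) (f : I -> R -> R)
    (s : seq I) :
  mutually_independent X -> uniq s ->
  (forall i, measurable_fun setT (f i)) -> (forall i x, 0 <= f i x) ->
  (\int[P]_w (\prod_(i <- s) f i (X i w))%:E =
   \prod_(i <- s) \int[P]_w (f i (X i w))%:E)%E.
Proof.
move=> indX us mf f0.
have mXB i B : measurable B -> measurable (X i @^-1` B).
  by move=> mB; rewrite -[_ @^-1` _]setTI; exact: measurable_funPT.
(* Indices in [s1] carry the functions [f i], those in [s2] still carry indicators. The induction on
   [s1] trades one indicator for a function at a time, starting from pure indicators, where the
   claim is independence itself. *)
suff H s1 s2 (B : I -> set R) : uniq (s1 ++ s2) -> (forall i, measurable (B i)) ->
    (\int[P]_w (\prod_(i <- s1) f i (X i w) * \prod_(i <- s2) \1_(X i @^-1` B i) w)%:E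
    = (\prod_(i <- s1) \int[P]_w (f i (X i w))%:E)
      * \prod_(i <- s2) P (X i @^-1` B i))%E.
  have := H s [::] (fun=> setT); rewrite cats0 big_nil mule1 => <- //.
  by apply: eq_integral => w _; rewrite big_nil mulr1.
elim: s1 s2 B => [|i s1 IH] s2 B /= us12 mB.
  have prodE w : \prod_(i <- s2) (\1_(X i @^-1` B i) w : R) =
      \1_(\bigcap_(i in [set` s2]) (X i @^-1` B i)) w.
    rewrite bigcap_seq; elim: (s2) => [|j s' IHs].
      by rewrite !big_nil indicE in_setT.
    by rewrite !big_cons IHs indicI.
  rewrite big_nil mul1e -indX//.
  under eq_integral do rewrite big_nil mul1r prodE.
  rewrite integral_indic ?setIT//.
  by rewrite bigcap_seq; apply: bigsetI_measurable => i _; exact: mXB.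
have /andP[ni _] := us12.
set g := fun w => \prod_(j <- s1) f j (X j w) * \prod_(j <- s2) \1_(X j @^-1` B j) w.
set c := ((\prod_(j <- s1) \int[P]_w (f j (X j w))%:E)
      * \prod_(j <- s2) P (X j @^-1` B j))%E.
have mg : measurable_fun setT g.
  apply: measurable_funM.
    by apply: measurable_prod => j _; apply: measurableT_comp.
  by apply: measurable_prod => j _; apply: measurable_indic; exact: mXB.
have g0 w : 0 <= g w by apply: mulr_ge0; apply: prodr_ge0.
have c0 : (0 <= c)%E.
  apply: mule_ge0; apply: prode_ge0 => j _ //.
  by apply: integral_ge0 => w _; rewrite lee_fin.
transitivity (\int[P]_w (g w * f i (X i w))%:E)%E.
  by apply: eq_integral => w _; rewrite big_cons /g -mulrA mulrC.
rewrite (@ge0_indep_integralM _ _ _ _ _ _ c)//; last first.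
  move=> C mC.
  (* An indicator at [i] is a case of the induction hypothesis with [i] moved to the second list and
     [C] as its set. *)
  pose B' j := if j == i then C else B j.
  have := IH (i :: s2) B'.
  rewrite !big_cons /B' eqxx => IH'.
  have s2E j : j \in s2 -> (j == i) = false.
    move=> js2; apply/negbTE/eqP => ji.
    by move: ni; rewrite mem_cat -ji js2 orbT.
  rewrite /c muleAC -muleA.
  transitivity (\int[P]_x (\prod_(i0 <- s1) f i0 (X i0 x) *
         \prod_(j <- (i :: s2)) \1_(X j @^-1` (B' j)) x)%:E)%E.
    apply: eq_integral => w _; rewrite big_cons /B' eqxx /g -mulrA [X in _ * X]mulrC.
    congr (_ * (_ * _))%:E; rewrite !big_seq; apply: eq_bigr => j js2.
    by rewrite s2E.
  rewrite IH; last 2 first.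
    by rewrite uniq_catC /= uniq_catC mem_cat orbC -mem_cat; exact: us12.
    by move=> j; rewrite /B'; case: ifP.
  rewrite big_cons /B' eqxx; congr (_ * (_ * _))%E.
  by rewrite !big_seq; apply: eq_bigr => j js2; rewrite s2E.
by rewrite big_cons /c muleC muleA.
Qed.

Lemma eq_dist_integral d (T : measurableType d) (R : realType)
    (P : probability T R) (X Y : {RV P >-> R}) (f : R -> R) :
  (forall B : set R, measurable B -> P (X @^-1` B) = P (Y @^-1` B)) ->
  measurable_fun setT f -> (forall x, 0 <= f x) ->
  (\int[P]_w (f (X w))%:E = \int[P]_w (f (Y w))%:E)%E.
Proof.
move=> XY mf f0.
have mEf : measurable_fun setT (EFin \o f) by exact/measurable_EFinP.
have H (Z : {RV P >-> R}) :
    (\int[P]_w (f (Z w))%:E = \int[distribution P Z]_x (f x)%:E)%E.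
  by rewrite [RHS]ge0_integral_pushforward//; move=> x _; rewrite lee_fin.
rewrite !H; apply: eq_measure_integral => B mB _; exact: XY.
Qed.

Lemma integral_expR_sum d (T : measurableType d) (R : realType)
    (P : probability T R) (k : nat) (X : 'I_k -> nat -> {RV P >-> R})
    (c : 'I_k * nat -> R) (s : seq ('I_k * nat)) :
  mutually_independent (fun p : 'I_k * nat => X p.1 p.2) ->
  (forall l n (B : set R), measurable B ->
      P (X l n @^-1` B) = P (X l 0%N @^-1` B)) ->
  uniq s ->
  (\int[P]_w (expR (\sum_(p <- s) c p * X p.1 p.2 w))%:E =
   \prod_(p <- s) \int[P]_w (expR (c p * X p.1 0%N w))%:E)%E.
Proof.
move=> indX eqX us.
have mexp a : measurable_fun setT (fun x : R => expR (a * x)).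
  by apply: measurableT_comp => //; exact: measurable_funM.
transitivity (\int[P]_w (\prod_(p <- s) expR (c p * X p.1 p.2 w))%:E)%E.
  by apply: eq_integral => w _; rewrite expR_sum.
rewrite (@indep_integral_prod _ _ _ _ _ (fun p : 'I_k * nat => X p.1 p.2)
  (fun p x => expR (c p * x)))//.
apply: eq_bigr => p _.
apply: (@eq_dist_integral _ _ _ _ _ _ (fun x => expR (c p * x))) => //.
by move=> B mB; exact: eqX.
Qed.

Lemma prode_const (R : realDomainType) (I : Type) (s : seq I) (x : \bar R) :
  (\prod_(i <- s) x = x ^+ size s)%E.
Proof.
elim: s => [|i s IH]; first by rewrite big_nil expe0.
by rewrite big_cons IH expeS.
Qed.

Lemma integral_expR_samples d (T : measurableType d) (R : realType)
    (P : probability T R) (k : nat) (X : 'I_k -> nat -> {RV P >-> R})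
    (i j : 'I_k) (a b : R) (n m : nat) :
  mutually_independent (fun p : 'I_k * nat => X p.1 p.2) ->
  (forall l n (B : set R), measurable B ->
      P (X l n @^-1` B) = P (X l 0%N @^-1` B)) ->
  i != j ->
  (\int[P]_w (expR (a * (\sum_(q < n) X i q w) + b * (\sum_(q < m) X j q w)))%:E =
   (\int[P]_w (expR (a * X i 0%N w))%:E) ^+ n *
   (\int[P]_w (expR (b * X j 0%N w))%:E) ^+ m)%E.
Proof.
move=> indX eqX ij.
pose s := [seq (i, q) | q <- iota 0 n] ++ [seq (j, q) | q <- iota 0 m].
pose c (p : 'I_k * nat) := if p.1 == i then a else b.
have us : uniq s.
  rewrite cat_uniq !map_inj_uniq ?iota_uniq ?andbT /=; try by move=> u v [].
  apply/hasPn => p /mapP[q _ ->]; apply/mapP => -[q' _ [] ji].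
  by move: ij; rewrite ji eqxx.
transitivity (\int[P]_w (expR (\sum_(p <- s) c p * X p.1 p.2 w))%:E)%E.
  apply: eq_integral => w _; congr (expR _)%:E.
  rewrite big_cat !big_map /= !big_distrr /c /= eqxx eq_sym (negbTE ij).
  by rewrite -[in RHS](subn0 n) -[in RHS](subn0 m) -!/(index_iota _ _) !big_mkord.
rewrite integral_expR_sum// big_cat !big_map /c /= eqxx eq_sym (negbTE ij).
by rewrite !prode_const !size_iota.
Qed.

Lemma integral_expR_sample d (T : measurableType d) (R : realType)
    (P : probability T R) (k : nat) (X : 'I_k -> nat -> {RV P >-> R})
    (l : 'I_k) (a : R) (n : nat) :
  mutually_independent (fun p : 'I_k * nat => X p.1 p.2) ->
  (forall l n (B : set R), measurable B ->
      P (X l n @^-1` B) = P (X l 0%N @^-1` B)) ->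
  (\int[P]_w (expR (a * (\sum_(q < n) X l q w)))%:E =
   (\int[P]_w (expR (a * X l 0%N w))%:E) ^+ n)%E.
Proof.
move=> indX eqX.
pose s := [seq (l, q) | q <- iota 0 n].
have us : uniq s by rewrite map_inj_uniq ?iota_uniq//; move=> u v [].
transitivity (\int[P]_w (expR (\sum_(p <- s) a * X p.1 p.2 w))%:E)%E.
  apply: eq_integral => w _; congr (expR _)%:E.
  rewrite big_map big_distrr /=.
  by rewrite -[in RHS](subn0 n) -!/(index_iota _ _) !big_mkord.
by rewrite (@integral_expR_sum _ _ _ _ _ _ (fun=> a))// big_map /= prode_const size_iota.
Qed.

(** * The logarithmic moment generating function of one sample *)

(** Jensen's inequality by the tangent line: [expR (t * Y)] lies above the tangent of [expR] at
    [t * mu], whose integral is [expR (t * mu)]. *)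
Lemma expR_mean_le d (T : measurableType d) (R : realType)
    (P : probability T R) (Y : {RV P >-> R}) (mu t : R) :
  P.-integrable setT (EFin \o Y) -> ('E_P[Y] = mu%:E)%E ->
  ((expR (t * mu))%:E <= \int[P]_w (expR (t * Y w))%:E)%E.
Proof.
move=> iY EY; set M := (X in (_ <= X)%E).
have [->|Mfin] := eqVneq M +oo%E; first by rewrite leey.
have mE : measurable_fun setT (fun w => (expR (t * Y w))%:E : \bar R).
  by apply/measurable_EFinP; apply: measurableT_comp => //; exact: measurable_funM.
have iE : P.-integrable setT (fun w => (expR (t * Y w))%:E).
  apply/integrableP; split => //.
  under eq_integral do rewrite gee0_abs ?lee_fin ?expR_ge0//.
  by rewrite ltey.
set c := expR (t * mu).
have i1 : P.-integrable setT (fun w => (c * (1 - t * mu))%:E : \bar R).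
  exact: finite_measure_integrable_cst.
have i2 : P.-integrable setT (fun w => (c * t)%:E * (Y w)%:E)%E.
  exact: integrableZl.
have -> : (c%:E = \int[P]_w ((c * (1 - t * mu))%:E + (c * t)%:E * (Y w)%:E))%E.
  rewrite integralD// integralZl// integral_cst//= probability_setT mule1.
  have -> : (\int[P]_w (Y w)%:E = mu%:E)%E by rewrite -EY unlock.
  by rewrite -EFinM -EFinD; congr EFin; ring.
apply: le_integral => //; first exact: integrableD.
move=> w _; rewrite -EFinM -EFinD lee_fin.
have -> : t * Y w = t * mu + t * (Y w - mu) by ring.
rewrite expRD -/c -mulrA -mulrDr ler_pM2l ?expR_gt0//.
by apply: le_trans (expR_ge1Dx _); rewrite le_eqVlt; apply/orP; left; apply/eqP; ring.
Qed.

Section log_mgf.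
Context d (T : measurableType d) (R : realType) (P : probability T R).
Variables (Y : {RV P >-> R}) (mu : R).
Hypotheses (iY : P.-integrable setT (EFin \o Y)) (EY : ('E_P[Y] = mu%:E)%E).

Let L := log_mgf P Y.
Let M t := (\int[P]_w (expR (t * Y w))%:E)%E.

(** Since [ln] has a default value at 0, strict positivity is what makes [log_mgf] the true
    logarithm wherever it is finite. *)
Let M_gt0 t : (0 < M t)%E.
Proof. by apply: lt_le_trans (expR_mean_le t iY EY); rewrite lte_fin expR_gt0. Qed.

Lemma log_mgf_lty t : (L t < +oo -> M t = (expR (real_part L t))%:E)%E.
Proof.
rewrite /L /real_part /log_mgf -/(M t).
have := M_gt0 t; case: (M t) => [m| |]//= m0 _.
by rewrite lnK.
Qed.

Lemma log_mgf_ltyP t : (L t < +oo)%E = (M t < +oo)%E.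
Proof.
have := M_gt0 t; rewrite /L /log_mgf -/(M t); case: (M t) => [m| |]//= _.
by rewrite !ltry.
Qed.

Lemma log_mgfE t : (L t < +oo -> L t = (real_part L t)%:E)%E.
Proof. by rewrite /L /real_part /log_mgf -/(M t); case: (M t) => [m| |]. Qed.

Lemma log_mgf0 : L 0 = 0%E.
Proof.
rewrite /L /log_mgf -/(M 0).
have -> : M 0 = 1%E.
  rewrite /M; under eq_integral do rewrite mul0r expR0.
  by rewrite integral_cst// mul1e; exact: probability_setT.
by rewrite /= ln1.
Qed.

Lemma log_mgf_ge t : ((t * mu)%:E <= L t)%E.
Proof.
have := expR_mean_le t iY EY; rewrite -/(M t) /L /log_mgf -/(M t).
have := M_gt0 t; case: (M t) => [m| |]//= m0; last by rewrite ?eqxx ?leey.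
by rewrite !lee_fin => h; rewrite -ler_expR lnK.
Qed.

Lemma log_mgf_convex a b p : 0 <= p <= 1 -> (L a < +oo -> L b < +oo ->
  L (p * a + (1 - p) * b)%R <=
  (p * real_part L a + (1 - p) * real_part L b)%:E)%E.
Proof.
(* Convexity of [expR] at the normalised exponents [a Y - L a] and [b Y - L b]
   replaces Hoelder's inequality. *)
move=> /andP[p0 p1] La Lb.
have [Ma Mb] := (log_mgf_lty La, log_mgf_lty Lb).
set u := real_part L a in Ma *; set v := real_part L b in Mb *.
have mE t c : measurable_fun setT (fun w => (expR (t * Y w - c))%:E : \bar R).
  apply/measurable_EFinP; apply: measurableT_comp => //.
  by apply: measurable_funB => //; exact: measurable_funM.
have I1 t c : M t = (expR c)%:E -> (\int[P]_w (expR (t * Y w - c))%:E = 1)%E.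
  move=> Mt.
  under eq_integral do rewrite expRD EFinM muleC.
  rewrite ge0_integralZl//; last first.
    by apply/measurable_EFinP; apply: measurableT_comp => //; exact: measurable_funM.
  by rewrite -/(M t) Mt -EFinM -expRD addNr expR0.
have Z k t c : 0 <= k -> (\int[P]_w (k%:E * (expR (t * Y w - c))%:E) =
    k%:E * \int[P]_w (expR (t * Y w - c))%:E)%E.
  move=> k0; apply: (@ge0_integralZl _ _ _ P _ measurableT
    (fun w => (expR (t * Y w - c))%:E) (mE t c) k%:E); last by rewrite lee_fin.
  by move=> w _; rewrite lee_fin expR_ge0.
set q := p * a + (1 - p) * b; set z := p * u + (1 - p) * v.
have Mq : (M q <= (expR z)%:E)%E.
  have -> : M q = ((expR z)%:E * \int[P]_w (expR (q * Y w - z))%:E)%E.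
    rewrite -(Z (expR z)) ?expR_ge0//.
    apply: eq_integral => w _; rewrite -EFinM -expRD; congr (expR _)%:E; ring.
  rewrite -[leRHS]mule1; apply: lee_wpmul2l; first by rewrite lee_fin expR_ge0.
  have -> : 1%E = (\int[P]_w (p%:E * (expR (a * Y w - u))%:E +
      (1 - p)%:E * (expR (b * Y w - v))%:E))%E.
    transitivity (\int[P]_w (p%:E * (expR (a * Y w - u))%:E) +
        \int[P]_w ((1 - p)%:E * (expR (b * Y w - v))%:E))%E; last first.
      apply/esym/ge0_integralD => //.
      - by move=> w _; rewrite mule_ge0// lee_fin expR_ge0.
      - exact: measurable_funeM.
      - by move=> w _; rewrite mule_ge0// lee_fin ?subr_ge0// expR_ge0.
      - exact: measurable_funeM.
    transitivity (p%:E * 1 + (1 - p)%:E * 1)%E.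
      by rewrite !mule1 -EFinD addrC subrK.
    congr (_ + _)%E; apply/esym.
      by rewrite Z// (I1 _ _ Ma).
    by rewrite Z ?subr_ge0// (I1 _ _ Mb).
  apply: ge0_le_integral => //.
  - by apply: emeasurable_funD; apply: measurable_funeM.
  - move=> w _; rewrite -!EFinM -EFinD lee_fin.
    have -> : q * Y w - z = p * (a * Y w - u) + (1 - p) * (b * Y w - v).
      by rewrite /q /z; ring.
    have := @convex_expR R (Itv01 p0 p1) (a * Y w - u) (b * Y w - v).
    by rewrite /conv /=.
have Lq : (L q < +oo)%E by rewrite log_mgf_ltyP (le_lt_trans Mq)// ltey.
by move: Mq; rewrite (log_mgf_lty Lq) (log_mgfE Lq) !lee_fin ler_expR.
Qed.

End log_mgf.

Lemma log_mgf_sample_mean d (T : measurableType d) (R : realType)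
    (P : probability T R) (k : nat) (X : 'I_k -> nat -> {RV P >-> R})
    (l : 'I_k) (mu t : R) (n : nat) :
  mutually_independent (fun p : 'I_k * nat => X p.1 p.2) ->
  (forall l n (B : set R), measurable B ->
      P (X l n @^-1` B) = P (X l 0%N @^-1` B)) ->
  P.-integrable setT (EFin \o X l 0%N) -> ('E_P[X l 0%N] = mu%:E)%E ->
  (0 < n)%N ->
  (log_mgf P (sample_mean (fun i => X l i) n) (n%:R * t) =
   n%:R%:E * log_mgf P (X l 0%N) t)%E.
Proof.
move=> indX eqX iX EX n0.
have nR0 : (n%:R : R) != 0 by rewrite pnatr_eq0 -lt0n.
rewrite {1}/log_mgf.
have -> : (\int[P]_w (expR (n%:R * t * sample_mean (fun i => X l i) n w))%:E =
    (\int[P]_w (expR (t * X l 0%N w))%:E) ^+ n)%E.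
  rewrite -integral_expR_sample//; apply: eq_integral => w _.
  by congr (expR _)%:E; rewrite /sample_mean; field.
rewrite /log_mgf; set M := (\int[P]_w _)%E.
have : (0 < M)%E.
  by apply: lt_le_trans (expR_mean_le t iX EX); rewrite lte_fin expR_gt0.
case: M => [m| |]//= m0.
  by rewrite -EFin_expe /= -EFinM lnXn// mulr_natl.
have -> : (+oo ^+ n = +oo :> \bar R)%E 
  by elim: n n0 {nR0} => [//|[|n] IH _]; rewrite ?expe1// expeS IH// mulyy.
by rewrite eqxx gt0_muley// lte_fin ltr0n.
Qed.

(** For i.i.d. samples the sequence of Assumption 1 is constant from [n = 1] on, so its limit is the
    value for a single sample. *)
Lemma limit_log_mgf d (T : measurableType d) (R : realType)
    (P : probability T R) (k : nat) (X : 'I_k -> nat -> {RV P >-> R})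
    (l : 'I_k) (mu t : R) (x : \bar R) :
  mutually_independent (fun p : 'I_k * nat => X p.1 p.2) ->
  (forall l n (B : set R), measurable B ->
      P (X l n @^-1` B) = P (X l 0%N @^-1` B)) ->
  P.-integrable setT (EFin \o X l 0%N) -> ('E_P[X l 0%N] = mu%:E)%E ->
  ((n%:R)^-1%:E * log_mgf P (sample_mean (fun i => X l i) n) (n%:R * t))%E
        @[n --> \oo] --> x ->
  x = log_mgf P (X l 0%N) t.
Proof.
move=> indX eqX iX EX; move/(cvg_unique _); apply => //.
apply: cvg_near_cst; exists 1%N => // n /= n0.
rewrite (log_mgf_sample_mean _ _ _ iX EX)// muleA -EFinM mulVf ?mul1e//.
by rewrite pnatr_eq0 -lt0n.
Qed.

(** * One-sided difference quotients and zeros of a derivative *)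

Section one_sided_derivative.
Context {R : realType}.
Implicit Types (f : R -> R) (x c : R).

Lemma derive1_quotient_cvg f x : derivable f x 1 ->
  (fun h => h^-1 * (f (x + h) - f x)) h @[h --> 0^'] --> derive1 f x.
Proof.
move=> df; rewrite derive1E.
have -> : (fun h => h^-1 * (f (x + h) - f x)) =
    (fun h => h^-1 *: ((f \o shift x) (h *: 1) - f x)).
  apply/funext => h /=; rewrite /shift /= (_ : h *: (1 : R) = h); last exact: mulr1.
  by rewrite [h + x]addrC.
exact: df.
Qed.

Lemma derive1_le_right f x c : derivable f x 1 ->
  (\forall h \near 0^'+, f (x + h) - f x <= h * c) -> derive1 f x <= c.
Proof.
move=> /derive1_quotient_cvg/cvg_dnbhs_at_right H fc.
apply: (cvgr_to_le H); near=> h.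
have h0 : 0 < h by near: h; exact: nbhs_right_gt.
by rewrite ler_pdivrMl//; near: h.
Unshelve. all: by end_near. Qed.

Lemma derive1_ge_right f x c : derivable f x 1 ->
  (\forall h \near 0^'+, h * c <= f (x + h) - f x) -> c <= derive1 f x.
Proof.
move=> /derive1_quotient_cvg/cvg_dnbhs_at_right H fc.
apply: (cvgr_to_ge H); near=> h.
have h0 : 0 < h by near: h; exact: nbhs_right_gt.
by rewrite ler_pdivlMl//; near: h.
Unshelve. all: by end_near. Qed.

Lemma derive1_le_left f x c : derivable f x 1 ->
  (\forall h \near 0^'-, h * c <= f (x + h) - f x) -> derive1 f x <= c.
Proof.
move=> /derive1_quotient_cvg/cvg_dnbhs_at_left H fc.
apply: (cvgr_to_le H); near=> h.
have h0 : h < 0 by near: h; exact: nbhs_left_lt.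
by rewrite ler_ndivrMl//; near: h.
Unshelve. all: by end_near. Qed.

(** Darboux's argument, with no continuity of the derivative: take a minimum point on [[0, b]]. In
    the interior the derivative vanishes there; at an end point minimality gives one sign and the
    hypothesis the other. *)
Lemma exists_derive1_eq0 f b : 0 < b ->
  (forall x, 0 <= x <= b -> derivable f x 1) -> derive1 f 0 <= 0 -> 0 <= derive1 f b ->
  exists2 c, 0 <= c <= b & derive1 f c = 0.
Proof.
move=> b0 df f0 fb.
have cf : {within `[0, b], continuous f}.
  apply: derivable_within_continuous => x; rewrite in_itv/=; exact: df.
have [c cb fc] := EVT_min (ltW b0) cf.
exists c; first by move: cb; rewrite in_itv.
move: (cb); rewrite in_itv/= => /andP[c0 cb'].
have [c00|cn0] := eqVneq c 0.
  apply/eqP; rewrite eq_le {1}c00 f0 /=; apply: derive1_ge_right; first exact: df.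
  near=> h; rewrite mulr0 subr_ge0; apply: fc; rewrite in_itv/= c00 add0r.
  by apply/andP; split; near: h; [exact: nbhs_right_ge|exact: nbhs_right_le].
have [cbb|cnb] := eqVneq c b.
  apply/eqP; rewrite eq_le {2}cbb fb andbT; apply: derive1_le_left; first exact: df.
  near=> h; rewrite mulr0 subr_ge0; apply: fc; rewrite in_itv/= cbb.
  have hb : - b <= h by near: h; apply: nbhs_left_ge; rewrite oppr_lt0.
  have h0 : h <= 0 by near: h; exact: nbhs_left_le.
  by lra.
have := @derive1_at_min _ f 0 b c (ltW b0).
rewrite derive1E => H; apply: (@derive_val _ _ _ _ _ _ _ (H _ _ _)).
- by move=> t; rewrite in_itv/= => /andP[t0 tb]; apply: df; rewrite !ltW.
- by rewrite in_itv/= !lt_neqAle eq_sym cn0 cnb c0.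
- by move=> t; rewrite in_itv/= => /andP[t0 tb]; apply: fc; rewrite in_itv/= !ltW.
Unshelve. all: by end_near. Qed.

End one_sided_derivative.

(** * Convex analysis of an extended-valued cumulant function *)

Section cumulant.
Context {R : realType}.
Variables (L : R -> \bar R) (mu : R).
Let K := real_part L.
Hypothesis LE : forall t, (L t < +oo -> L t = (K t)%:E)%E.
Hypothesis L_convex : forall a b p, 0 <= p <= 1 -> (L a < +oo -> L b < +oo ->
  L (p * a + (1 - p) * b)%R <= (p * K a + (1 - p) * K b)%:E)%E.

Lemma eff_dom_convex a b p : 0 <= p <= 1 -> eff_dom L a -> eff_dom L b ->
  eff_dom L (p * a + (1 - p) * b).
Proof. by move=> p01 La Lb; apply: le_lt_trans (L_convex p01 La Lb) _; rewrite ltry. Qed.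

Lemma real_part_convex a b p : 0 <= p <= 1 -> eff_dom L a -> eff_dom L b ->
  K (p * a + (1 - p) * b) <= p * K a + (1 - p) * K b.
Proof.
move=> p01 La Lb; have := L_convex p01 La Lb.
by rewrite LE ?lee_fin//; exact: eff_dom_convex.
Qed.

Lemma interior_eff_dom_convex a b p : 0 <= p <= 1 ->
  interior (eff_dom L) a -> interior (eff_dom L) b ->
  interior (eff_dom L) (p * a + (1 - p) * b).
Proof.
move=> p01 /nbhs_ballP[e e0 ae] /nbhs_ballP[e' e'0 be].
apply/nbhs_ballP; exists (Num.min e e'); first by rewrite /= lt_min e0.
move=> z; rewrite /ball/= lt_min => /andP[ze ze'].
(* Both end points are shifted by the same vector, so the smaller of the two radii works for the
   combination. *)
have -> : z = p * (a + (z - (p * a + (1 - p) * b)))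
    + (1 - p) * (b + (z - (p * a + (1 - p) * b))) by ring.
apply: eff_dom_convex => //; [apply: ae|apply: be]; rewrite /ball/=.
  by rewrite opprD addNKr normrN distrC.
by rewrite opprD addNKr normrN distrC.
Qed.

Lemma interior_eff_dom_itv a b x : interior (eff_dom L) a -> interior (eff_dom L) b ->
  a <= x <= b -> interior (eff_dom L) x.
Proof.
move=> La Lb /andP[ax xb].
have [ab|ab] := ltP a b; last first.
  by have -> : x = a by apply/eqP; rewrite eq_le ax (le_trans xb ab).
have ba0 : 0 < b - a by rewrite subr_gt0.
have -> : x = (b - x) / (b - a) * a + (1 - (b - x) / (b - a)) * b.
  by field; rewrite gt_eqF.
apply: interior_eff_dom_convex => //.
by rewrite divr_ge0 ?subr_ge0 ?(ltW ab)//= ler_pdivrMr// mul1r lerD2l lerN2.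
Qed.

(** Along the segment from [a] to [s], convexity keeps the initial slope below the increment of the
    chord. The point [s] may lie on the boundary of [eff_dom L], which the supremum in
    [FL_transform_derive] requires. *)
Lemma subgradient a s : derivable K a 1 -> eff_dom L a -> eff_dom L s ->
  K a + derive1 K a * (s - a) <= K s.
Proof.
move=> dK La Ls.
pose g p := K (a + p * (s - a)).
have ldg : is_derive (0 : R) 1 (fun p : R => a + p * (s - a)) (s - a).
  apply: is_derive_eq. by rewrite scaler0 !add0r mul1r; exact: mulr1.
have dKa : is_derive (a + 0 * (s - a)) 1 K (derive1 K a).
  by rewrite mul0r addr0 derive1E; exact: derivableP.
have dg : is_derive (0 : R) 1 g (derive1 K a * (s - a)).
  exact: (@is_derive1_comp _ K (fun p : R => a + p * (s - a)) 0 _ _ dKa ldg).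
rewrite -lerBrDl -(@derive_val _ _ _ _ _ _ _ dg) -derive1E.
apply: derive1_le_right => //.
near=> h.
have h0 : 0 <= h by near: h; exact: nbhs_right_ge.
have h1 : h <= 1 by near: h; exact: nbhs_right_le.
rewrite /g add0r mul0r addr0.
have -> : a + h * (s - a) = h * s + (1 - h) * a by ring.
have /real_part_convex/(_ Ls La) H : 0 <= h <= 1 by rewrite h0 h1.
by rewrite lerBlDr (le_trans H)// le_eqVlt; apply/orP; left; apply/eqP; ring.
Unshelve. all: by end_near. Qed.

(** Add the subgradient inequalities at [a] and at [b]. *)
Lemma derive1_nondecreasing a b : derivable K a 1 -> derivable K b 1 ->
  eff_dom L a -> eff_dom L b -> a <= b -> derive1 K a <= derive1 K b.
Proof.
move=> dKa dKb La Lb; rewrite le_eqVlt => /orP[/eqP-> //|ab].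
have H1 := subgradient dKa La Lb; have H2 := subgradient dKb Lb La.
rewrite -(ler_pM2r (_ : 0 < b - a)) ?subr_gt0//.
by rewrite -[a - b]opprB mulrN in H2; lra.
Qed.

(** At the midpoint of [a] and [s] the subgradient inequality bounds [K] from below, while strict
    convexity puts it strictly below the mean of the end values. *)
Lemma subgradient_strict a s :
  (forall x y t, interior (eff_dom L) x -> interior (eff_dom L) y -> x != y ->
    0 < t < 1 -> K (t * x + (1 - t) * y) < t * K x + (1 - t) * K y) ->
  derivable K a 1 -> interior (eff_dom L) a -> interior (eff_dom L) s -> a != s ->
  K a + derive1 K a * (s - a) < K s.
Proof.
move=> Ks dK La Ls as'.
have h2 : 0 < (2^-1 : R) < 1 by apply/andP; split; lra.
have h2' : 0 <= (2^-1 : R) <= 1 by apply/andP; split; lra.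
have Lm := interior_eff_dom_convex h2' La Ls.
have := Ks _ _ _ La Ls as' h2.
have := subgradient dK (interior_subset La) (interior_subset Lm).
set x := K _; set d := derive1 K a; set y := K a; set z := K s.
have -> : 2^-1 * a + (1 - 2^-1) * s - a = 2^-1 * (s - a) by field.
set w := s - a; move=> H1 H2; rewrite [d * _]mulrCA in H1; lra.
Qed.

Lemma FL_transform_ge a x : (L a < +oo -> (a * x - K a)%:E <= FL_transform L x)%E.
Proof.
by move=> La; apply: ereal_sup_ubound; exists a => //; rewrite (LE La) EFinB.
Qed.

(** Equality in Fenchel-Young: by the subgradient inequality the supremum is attained at [a]; points
    with [L s = +oo] contribute [-oo]. *)
Lemma FL_transform_derive a : derivable K a 1 -> eff_dom L a ->
  FL_transform L (derive1 K a) = (a * derive1 K a - K a)%:E.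
Proof.
move=> dK La; apply/eqP; rewrite eq_le FL_transform_ge// andbT.
apply: ub_ereal_sup => _ [s _ <-].
have [Ls|] := ltP (L s) +oo%E; last by rewrite leye_eq => /eqP ->; rewrite addeNy leNye.
rewrite (LE Ls) -EFinB lee_fin.
by have := subgradient dK La Ls; lra.
Qed.

Hypothesis L0 : L 0 = 0%E.
Hypothesis L_ge : forall t, ((t * mu)%:E <= L t)%E.

Lemma real_part_ge t : eff_dom L t -> t * mu <= K t.
Proof. by move=> Lt; have := L_ge t; rewrite LE. Qed.

(** The line [t * mu] lies below [K] and meets it at 0, so the left and right quotients squeeze the
    derivative. No differentiation under the integral is involved. *)
Lemma derive1_real_part0 : derivable K 0 1 -> interior (eff_dom L) 0 -> derive1 K 0 = mu.
Proof.
move=> dK /nbhs_ballP[e /= e0 Le].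
have K0 : K 0 = 0 by rewrite /K /real_part L0.
have geK h : `|h| < e -> h * mu <= K (0 + h).
  by move=> he; rewrite add0r real_part_ge//; apply: Le; rewrite /ball/= sub0r normrN.
apply/eqP; rewrite eq_le; apply/andP; split.
  apply: derive1_le_left => //; near=> h; rewrite K0 subr0; apply: geK.
  have h0 : h < 0 by near: h; exact: nbhs_left_lt.
  rewrite ltr0_norm// ltrNl; near: h.
  by apply: nbhs_left_gt; rewrite oppr_lt0.
apply: derive1_ge_right => //; near=> h; rewrite K0 subr0; apply: geK.
have h0 : 0 < h by near: h; exact: nbhs_right_gt.
by rewrite gtr0_norm//; near: h; exact: nbhs_right_lt.
Unshelve. all: by end_near. Qed.

End cumulant.

(** This interface separates the analysis from the probability: [is_cgf] holds for the log-mgf of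
    every integrable variable with mean [mu] ([is_cgf_log_mgf]), while [regular] is drawn from
    Assumptions 2 and 3. *)
Definition is_cgf {R : realType} (L : R -> \bar R) (mu : R) : Prop :=
  [/\ forall t, (L t < +oo -> L t = (real_part L t)%:E)%E,
      forall a b p, 0 <= p <= 1 -> (L a < +oo -> L b < +oo ->
        L (p * a + (1 - p) * b)%R <=
        (p * real_part L a + (1 - p) * real_part L b)%:E)%E,
      L 0 = 0%E &
      forall t, ((t * mu)%:E <= L t)%E].

Definition regular {R : realType} (L : R -> \bar R) : Prop :=
  [/\ interior (eff_dom L) 0,
      (forall t, interior (eff_dom L) t -> derivable (real_part L) t 1) &
      forall x y t, interior (eff_dom L) x ->
        interior (eff_dom L) y -> x != y -> 0 < t < 1 ->
        real_part L (t * x + (1 - t) * y) <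
        t * real_part L x + (1 - t) * real_part L y].

(** * The critical point of a pair and the value of the rate function *)

Section critical_point.
Context {R : realType}.
Variables (Li Lj : R -> \bar R) (mui muj ri rj : R).
Hypotheses (Lic : is_cgf Li mui) (Ljc : is_cgf Lj muj).
Hypotheses (Lir : regular Li) (Ljr : regular Lj).
Hypotheses (ri0 : 0 < ri) (rj0 : 0 < rj).

Let Ki := real_part Li.
Let Kj := real_part Lj.

(** The function H of the overview, with [i] the better alternative. *)
Definition pair_cgf (th : R) := rj * Kj (th / rj) + ri * Ki (- th / ri).

Let is_derive_pair_cgf th : interior (eff_dom Lj) (th / rj) ->
  interior (eff_dom Li) (- th / ri) ->
  is_derive th 1 pair_cgf (derive1 Kj (th / rj) - derive1 Ki (- th / ri)).
Proof.
move=> Ljth Lith; have [_ dKi _] := Lir; have [_ dKj _] := Ljr.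
have dj : is_derive (th / rj) 1 Kj (derive1 Kj (th / rj)).
  by rewrite derive1E; apply: derivableP; exact: dKj.
have di : is_derive (- th / ri) 1 Ki (derive1 Ki (- th / ri)).
  by rewrite derive1E; apply: derivableP; exact: dKi.
have lj : is_derive th 1 (fun t : R => t / rj) rj^-1.
  by apply: is_derive_eq; rewrite scaler0 add0r; exact: mulr1.
have li : is_derive th 1 (fun t : R => - t / ri) (- ri^-1).
  apply: is_derive_eq. by rewrite scaler0 add0r scalerN; congr (- _); exact: mulr1.
have cj := @is_derive1_comp _ Kj (fun t : R => t / rj) th _ _ dj lj.
have ci := @is_derive1_comp _ Ki (fun t : R => - t / ri) th _ _ di li.
have := is_deriveD (is_deriveZ rj cj) (is_deriveZ ri ci).
rewrite -![_ *: _]/(_ * _) => H; apply: is_derive_eq.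
by field; rewrite !gt_eqF.
Qed.

Lemma pair_cgf_critical : muj < mui -> deriv_range Lj mui -> deriv_range Li muj ->
  exists th, [/\ 0 <= th, interior (eff_dom Lj) (th / rj),
    interior (eff_dom Li) (- th / ri) &
    derive1 Kj (th / rj) = derive1 Ki (- th / ri)].
Proof.
move=> mu_lt [aj Laj Kaj] [ai Lai Kai].
have [LiE Liconv Li0 Lige] := Lic; have [LjE Ljconv Lj0 Ljge] := Ljc.
have [Lii dKi _] := Lir; have [Lji dKj _] := Ljr.
have Ki0 : derive1 Ki 0 = mui by apply: (derive1_real_part0 LiE) => //; exact: dKi.
have Kj0 : derive1 Kj 0 = muj by apply: (derive1_real_part0 LjE) => //; exact: dKj.
(* The slope of [Kj] is [muj] at 0 and the larger [mui] at [aj]; monotonicity of the slope fixes the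
   sign of [aj], and likewise that of [ai]. *)
have aj0 : 0 < aj.
  rewrite ltNge; apply/negP => aj0.
  have := derive1_nondecreasing LjE Ljconv (dKj _ Laj) (dKj _ Lji)
    (interior_subset Laj) (interior_subset Lji) aj0.
  by rewrite Kaj -/Kj Kj0 leNgt mu_lt.
have ai0 : ai < 0.
  rewrite ltNge; apply/negP => ai0.
  have := derive1_nondecreasing LiE Liconv (dKi _ Lii) (dKi _ Lai)
    (interior_subset Lii) (interior_subset Lai) ai0.
  by rewrite Kai -/Ki Ki0 leNgt mu_lt.
(* The largest [b] for which [th / rj <= aj] and [ai <= - th / ri] on all of [[0, b]], so that both
   arguments stay inside the domains. *)
pose b := Num.min (rj * aj) (- ri * ai).
have b0 : 0 < b by rewrite lt_min mulr_gt0//= mulNr oppr_gt0 pmulr_rlt0.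
have bj : b / rj <= aj by rewrite ler_pdivrMr// mulrC ge_min lexx.
have bi : ai <= - b / ri.
  by rewrite mulNr lerNr ler_pdivrMr// mulNr mulrC -mulNr ge_min lexx orbT.
have Ljx x : 0 <= x <= b -> interior (eff_dom Lj) (x / rj).
  move=> /andP[x0 xb]; apply: (interior_eff_dom_itv Ljconv Lji Laj).
  by rewrite divr_ge0 ?(ltW rj0)//= (le_trans _ bj)// ler_pM2r// invr_gt0.
have Lix x : 0 <= x <= b -> interior (eff_dom Li) (- x / ri).
  move=> /andP[x0 xb]; apply: (interior_eff_dom_itv Liconv Lai Lii).
  rewrite (le_trans bi) ?ler_pM2r ?invr_gt0 ?lerN2//=.
  by rewrite mulNr oppr_le0 divr_ge0// ltW.
have dP x : 0 <= x <= b ->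
    derive1 pair_cgf x = derive1 Kj (x / rj) - derive1 Ki (- x / ri).
  move=> xb; rewrite derive1E; apply: derive_val.
  by apply: is_derive_pair_cgf; [exact: Ljx|exact: Lix].
have b00 : 0 <= (0 : R) <= b by rewrite lexx ltW.
have bbb : 0 <= b <= b by rewrite lexx ltW.
have [||||th thb th0] := @exists_derive1_eq0 _ pair_cgf b.
- exact: b0.
- by move=> x xb; have [] := is_derive_pair_cgf (Ljx _ xb) (Lix _ xb).
- by rewrite dP// oppr0 !mul0r Ki0 Kj0 subr_le0 ltW.
- rewrite dP// subr_ge0.
  (* One of the two constraints is tight at [b]. Either the slope of [Kj] has reached [mui], which
     the slope of [Ki] does not exceed left of 0, or the slope of [Ki] has dropped to [muj], which
     is at most the slope of [Kj] right of 0. *)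
  have [h|h] := leP (rj * aj) (- ri * ai).
    have -> : b / rj = aj by rewrite /b min_l// mulrC mulKf// gt_eqF.
    rewrite Kaj -Ki0; apply: (derive1_nondecreasing LiE Liconv) => //.
    + by apply: dKi; exact: Lix.
    + exact: dKi.
    + by apply: interior_subset; exact: Lix.
    + exact: interior_subset.
    + by rewrite mulNr oppr_le0 divr_ge0// ltW.
  have -> : - b / ri = ai.
    by rewrite /b min_r ?(ltW h)//; field; rewrite gt_eqF.
  rewrite Kai -Kj0; apply: (derive1_nondecreasing LjE Ljconv) => //.
  + exact: dKj.
  + by apply: dKj; exact: Ljx.
  + exact: interior_subset.
  + by apply: interior_subset; exact: Ljx.
  + by rewrite divr_ge0// ltW.
exists th; split.
- by case/andP: thb.
- exact: Ljx.
- exact: Lix.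
- by apply/eqP; rewrite -subr_eq0 -dP// th0.
Qed.

Variable th : R.
Hypotheses (Ljth : interior (eff_dom Lj) (th / rj))
  (Lith : interior (eff_dom Li) (- th / ri))
  (Kth : derive1 Kj (th / rj) = derive1 Ki (- th / ri)).

Lemma inf_FL_transform :
  ereal_inf (range (fun x : R =>
    (ri%:E * FL_transform Li x + rj%:E * FL_transform Lj x)%E)) =
  (- pair_cgf th)%:E.
Proof.
have [LiE Liconv _ _] := Lic; have [LjE Ljconv _ _] := Ljc.
have [_ dKi _] := Lir; have [_ dKj _] := Ljr.
(* The multiples of [x] cancel, so one constant bounds the objective from below at every [x], and it
   is attained at the common slope. *)
have E x : - pair_cgf th = ri * (- th / ri * x - Ki (- th / ri)) +
    rj * (th / rj * x - Kj (th / rj)).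
  by rewrite /pair_cgf; field; rewrite !gt_eqF.
apply/eqP; rewrite eq_le; apply/andP; split.
  apply: ereal_inf_lbound; exists (derive1 Ki (- th / ri)) => //.
  rewrite -{2}Kth (FL_transform_derive LiE Liconv (dKi _ Lith) (interior_subset Lith)).
  rewrite (FL_transform_derive LjE Ljconv (dKj _ Ljth) (interior_subset Ljth)).
  by rewrite (E (derive1 Ki (- th / ri))) Kth EFinD !EFinM.
apply/ereal_infP => _ [x _ <-].
rewrite (E x) EFinD !EFinM.
apply: leeD.
  apply: lee_wpmul2l; first by rewrite lee_fin ltW.
  exact: (FL_transform_ge LiE x (interior_subset Lith)).
apply: lee_wpmul2l; first by rewrite lee_fin ltW.
exact: (FL_transform_ge LjE x (interior_subset Ljth)).
Qed.

Lemma pair_cgf_is_derive0 : is_derive th 1 pair_cgf 0.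
Proof. by rewrite -(subrr (derive1 Kj (th / rj))) {2}Kth; exact: is_derive_pair_cgf. Qed.

(** In the subgradient inequalities at [th] the linear increments [k * h] and [- k * h] cancel
    because the slopes agree; strictness comes from [Lj]. *)
Lemma pair_cgf_lt h : 0 < h -> interior (eff_dom Lj) ((th + h) / rj) ->
  interior (eff_dom Li) (- (th + h) / ri) -> pair_cgf th < pair_cgf (th + h).
Proof.
move=> h0 Ljh Lih.
have [LiE Liconv _ _] := Lic; have [LjE Ljconv _ _] := Ljc.
have [_ dKi _] := Lir; have [_ dKj Kjs] := Ljr.
have := subgradient LiE Liconv (dKi _ Lith) (interior_subset Lith) (interior_subset Lih).
have := subgradient_strict LjE Ljconv Kjs (dKj _ Ljth) Ljth Ljh.
rewrite -/Ki -/Kj => /(_ _) H1 H2.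
have {}H1 : Kj (th / rj) + derive1 Kj (th / rj) * ((th + h) / rj - th / rj) <
    Kj ((th + h) / rj).
  apply: H1; rewrite mulrDl -subr_eq0 opprD addrA subrr sub0r oppr_eq0.
  by rewrite mulf_neq0// ?invr_eq0 gt_eqF.
rewrite /pair_cgf.
move: H1 H2; rewrite -(ltr_pM2l rj0) -(ler_pM2l ri0) Kth.
set k := derive1 _ _; set x := Kj _; set y := Kj _; set x' := Ki _; set y' := Ki _.
have -> : rj * (x + k * ((th + h) / rj - th / rj)) = rj * x + k * h.
  by field; rewrite gt_eqF.
have -> : ri * (x' + k * (- (th + h) / ri - (- th / ri))) = ri * x' - k * h.
  by field; rewrite gt_eqF.
lra.
Qed.

Lemma near_pair_dom : \forall h \near (0 : R)^'+,
  interior (eff_dom Lj) ((th + h) / rj) /\ interior (eff_dom Li) (- (th + h) / ri).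
Proof.
have nbhsj : nbhs (th / rj) (interior (eff_dom Lj)) by exact: nbhs_interior.
have nbhsi : nbhs (- th / ri) (interior (eff_dom Li)) by exact: nbhs_interior.
have cj : (th + h) / rj @[h --> (0 : R)^'+] --> th / rj.
  apply: cvg_at_right_filter; have -> : th / rj = (th + 0) / rj by rewrite addr0.
  by apply: cvgMl; apply: cvgD; [exact: cvg_cst|exact: cvg_id].
have ci : - (th + h) / ri @[h --> (0 : R)^'+] --> - th / ri.
  apply: cvg_at_right_filter; have -> : - th / ri = - (th + 0) / ri by rewrite addr0.
  by apply: cvgMl; apply: cvgN; apply: cvgD; [exact: cvg_cst|exact: cvg_id].
near=> h; split; near: h; [exact: (cj _ nbhsj)|exact: (ci _ nbhsi)].
Unshelve. all: by end_near. Qed.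

End critical_point.

(** * Upper and lower bounds for a probability by exponential moments *)

Section exponential_bounds.
Context d (T : measurableType d) (R : realType) (P : probability T R).
Variable Z : T -> R.
Hypothesis mZ : measurable_fun setT Z.

Let mZ0 : measurable [set w | 0 <= Z w].
Proof.
have -> : [set w | 0 <= Z w] = setT `&` Z @^-1` `[0, +oo[.
  by apply/seteqP; split => w /=; rewrite in_itv/= andbT => // -[].
by apply: mZ => //; exact: measurable_itv.
Qed.

Let mexp s : measurable_fun setT (fun w => (expR (s * Z w))%:E : \bar R).
Proof.
by apply/measurable_EFinP; apply: measurableT_comp => //; exact: measurable_funM.
Qed.

Let int_indic : (\int[P]_w (\1_[set w | (0 <= Z w)%R] w)%:E = P [set w | (0 <= Z w)%R])%E.
Proof. by rewrite integral_indic// setIT. Qed.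

(** Chernoff's bound: the indicator of [0 <= Z] is at most [expR (s * Z)]. *)
Lemma prob_ge0_le_mgf s : 0 <= s ->
  (P [set w | (0 <= Z w)%R] <= \int[P]_w (expR (s * Z w))%:E)%E.
Proof.
move=> s0; rewrite -int_indic; apply: ge0_le_integral => //.
- by apply/measurable_EFinP; apply: measurable_indic.
- move=> w _; rewrite lee_fin indicE; case: (boolP (w \in _)) => [|_]; last first.
    exact: expR_ge0.
  by rewrite inE /= => Zw; rewrite -expR0 ler_expR mulr_ge0.
Qed.

(* The three terms dominate expR (s * Z) on 0 <= Z <= c, Z < 0 and c < Z. *)
Lemma mgf_le_prob_ge0 s h c : 0 <= s -> 0 <= h ->
  (\int[P]_w (expR (s * Z w))%:E <=
   (expR (s * c))%:E * P [set w | (0 <= Z w)%R] +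
   \int[P]_w (expR ((s - h) * Z w))%:E +
   (expR (- (h * c)))%:E * \int[P]_w (expR ((s + h) * Z w))%:E)%E.
Proof.
move=> s0 h0; rewrite -int_indic.
have e0 x : (0 <= (expR x)%:E :> \bar R)%E by rewrite lee_fin expR_ge0.
have m1 : measurable_fun setT
    (fun w => (\1_[set w | 0 <= Z w] w)%:E : \bar R).
  by apply/measurable_EFinP; exact: measurable_indic.
have i1 : (0 <= \int[P]_w ((\1_[set w | (0 <= Z w)%R] w)%:E : \bar R))%E.
  by apply: integral_ge0 => w _; rewrite lee_fin.
pose f1 w := ((expR (s * c))%:E * (\1_[set w | (0 <= Z w)%R] w)%:E)%E.
pose f2 w := (expR ((s - h) * Z w))%:E.
pose f3 w := ((expR (- (h * c)))%:E * (expR ((s + h) * Z w))%:E)%E.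
have f10 w : setT w -> (0 <= f1 w)%E by move=> _; rewrite mule_ge0// lee_fin.
have f20 w : setT w -> (0 <= f2 w)%E by move=> _; exact: e0.
have f30 w : setT w -> (0 <= f3 w)%E by move=> _; rewrite mule_ge0.
have mf1 : measurable_fun setT f1 by exact: measurable_funeM.
have mf2 : measurable_fun setT f2 by exact: mexp.
have mf3 : measurable_fun setT f3 by apply: measurable_funeM; exact: mexp.
have -> : ((expR (s * c))%:E * \int[P]_w (\1_[set w | (0 <= Z w)%R] w)%:E =
    \int[P]_w f1 w)%E.
  by apply/esym/ge0_integralZl => // w _; rewrite lee_fin.
have -> : ((expR (- (h * c)))%:E * \int[P]_w (expR ((s + h) * Z w))%:E =
    \int[P]_w f3 w)%E.
  by apply/esym/ge0_integralZl => //; exact: mexp.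
rewrite -[X in (X + _)%E](ge0_integralD _ measurableT f10 mf1 f20 mf2).
have f120 w : setT w -> (0 <= f1 w + f2 w)%E.
  by move=> _; rewrite adde_ge0// ?f10 ?f20.
rewrite -(ge0_integralD _ measurableT f120 (emeasurable_funD mf1 mf2) f30 mf3).
apply: ge0_le_integral => //.
  by apply: emeasurable_funD => //; exact: emeasurable_funD.
move=> w _; rewrite /f1 /f2 /f3 -!EFinM -!EFinD lee_fin indicE.
have [Zw|Zw] := leP 0 (Z w).
  rewrite mem_set// mulr1.
  have [Zc|Zc] := leP (Z w) c.
    have h1 : expR (s * Z w) <= expR (s * c) by rewrite ler_expR ler_wpM2l.
    have h2 := expR_ge0 ((s - h) * Z w).
    have h3 := mulr_ge0 (expR_ge0 (- (h * c))) (expR_ge0 ((s + h) * Z w)).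
    lra.
  rewrite -[leLHS]add0r lerD ?addr_ge0 ?expR_ge0// -expRD ler_expR.
  rewrite mulrDl addrCA lerDl addrC subr_ge0 ler_wpM2l//; exact: ltW.
rewrite memNset ?mulr0 ?add0r; last by move=> /=; rewrite leNgt Zw.
rewrite -[leLHS]addr0 lerD ?mulr_ge0 ?expR_ge0// ler_expR mulrBl lerBrDl.
by rewrite -[leRHS]add0r lerD2r mulr_ge0_le0// ltW.
Qed.

End exponential_bounds.

(** * From the moment bounds to an exponential rate *)

Section rate.
Context {R : realType}.

(** Applied with [c = 2], because the lower bound involves [th + 2 * h] as well as [th + h]. *)
Lemma near_right_scale (Q : R -> Prop) c : 0 < c ->
  (\forall h \near (0 : R)^'+, Q h) -> \forall h \near (0 : R)^'+, Q (c * h).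
Proof.
move=> c0 Qh.
have H : c * h @[h --> (0 : R)^'+] --> (0 : R)^'+.
  move=> A [e /= e0 eA]; exists (e / c); first by rewrite /= divr_gt0.
  move=> z /=; rewrite sub0r normrN ltr_pdivlMr// => ze z0.
  apply: eA; rewrite /= ?mulr_gt0// sub0r normrN normrM (gtr0_norm c0) mulrC.
  exact: ze.
exact: H.
Qed.

(** Here [F t s] stands for log E e^(sZ) / t and [p t] for P(0 <= Z). For given [e] one [h] is fixed
    before [t] grows, so convergence of [F] at the three points [th], [th + h] and [th + 2 * h]
    suffices. *)
Lemma exponential_rate (p : R -> R) (F : R -> R -> R) (H : R -> R) (th : R) :
  0 <= th -> is_derive th 1 H 0 ->
  F t th @[t --> +oo] --> H th ->
  (\forall t \near +oo, p t <= expR (t * F t th)) ->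
  (\forall h \near 0^'+, [/\ H th < H (th + h),
     F t (th + h) @[t --> +oo] --> H (th + h),
     F t (th + 2 * h) @[t --> +oo] --> H (th + 2 * h) &
     forall c, 0 < c -> \forall t \near +oo,
       expR (t * F t (th + h)) <= expR ((th + h) * (t * c)) * p t +
         expR (t * F t th) + expR (- (h * (t * c))) * expR (t * F t (th + 2 * h))]) ->
  forall e, 0 < e ->
    \forall t \near +oo, expR (t * (H th - e)) <= p t <= expR (t * (H th + e)).
Proof.
move=> th0 dH Fth pu pl e e0.
(* Chosen so that for [h < 1] the factor [expR ((th + h) * (t * c))] in front of [p t] costs at most
   [e / 4] in the rate. *)
pose c := e / (4 * (th + 1)).
have c0 : 0 < c by rewrite divr_gt0// mulr_gt0// ltr_wpDl.
have ce : (th + 1) * c = e / 4 by rewrite /c; field; rewrite gt_eqF// ltr_wpDl.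
(* This is where the vanishing derivative enters: at [2 * h] it bounds the increment of [H] by
   [h * c / 2], half of the decay rate [h * c] of the upper tail. *)
have Hd : \forall h \near 0^'+, H (th + h) - H th <= h * (c / 4).
  have dth : derivable H th 1 by [].
  have := @derive1_quotient_cvg R H th dth; rewrite derive1E (@derive_val _ _ _ _ _ _ _ dH).
  move=> /cvg_dnbhs_at_right/cvgr_le/(_ (c / 4)) Q.
  have c40 : 0 < c / 4 by rewrite divr_gt0.
  near=> h; have h0 : 0 < h by near: h; exact: nbhs_right_gt.
  by rewrite -ler_pdivrMl//; near: h; exact: Q.
have {}Hd := near_right_scale (ltr0Sn _ 1) Hd.
have [h [/andP[h0 h1] [Hth F1 F2 /(_ c c0) pl1] Hd2]] : exists h, [/\ 0 < h < 1 ,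
   [/\ H th < H (th + h),
     F t (th + h) @[t --> +oo] --> H (th + h),
     F t (th + 2 * h) @[t --> +oo] --> H (th + 2 * h) &
     forall c, 0 < c -> \forall t \near +oo,
       expR (t * F t (th + h)) <= expR ((th + h) * (t * c)) * p t +
         expR (t * F t th) + expR (- (h * (t * c))) * expR (t * F t (th + 2 * h))] &
    H (th + 2 * h) - H th <= 2 * h * (c / 4)].
  apply: (@filter_ex _ ((0 : R)^'+)); near=> h; split.
  - by apply/andP; split; near: h; [exact: nbhs_right_gt|exact: nbhs_right_lt].
  - by near: h.
  - by near: h.
(* The tolerance for [F t] against [H]. The three entries serve, in order, the part [Z < 0], the
   part above [c * t], and the final error [e]. *)
pose k := Num.min ((H (th + h) - H th) / 4) (Num.min (h * c / 8) (e / 4)).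
have k0 : 0 < k by rewrite lt_min divr_gt0 ?subr_gt0// lt_min !divr_gt0// mulr_gt0.
have k1 : k <= (H (th + h) - H th) / 4 by rewrite ge_min lexx.
have k2 : k <= h * c / 8 by rewrite !ge_min lexx orbT.
have k3 : k <= e / 4 by rewrite !ge_min lexx !orbT.
have ch : (th + h) * c <= e / 4 by rewrite -ce ler_pM2r// lerD2l ltW.
near=> t.
have t0 : 0 < t by near: t; exact: nbhs_pinfty_gt.
apply/andP; split; last first.
  apply: (@le_trans _ _ (expR (t * F t th))); first by near: t.
  rewrite ler_expR ler_pM2l//; near: t; apply: (cvgr_le _ Fth).
  by rewrite ltrDl.
have a1 : H (th + h) - k <= F t (th + h).
  by near: t; apply: (cvgr_ge _ F1); rewrite ltrBlDr ltrDl.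
have a2 : F t th <= H th + k by near: t; apply: (cvgr_le _ Fth); rewrite ltrDl.
have a3 : F t (th + 2 * h) <= H (th + 2 * h) + k.
  by near: t; apply: (cvgr_le _ F2); rewrite ltrDl.
have b : expR (t * F t (th + h)) <= expR ((th + h) * (t * c)) * p t +
         expR (t * F t th) + expR (- (h * (t * c))) * expR (t * F t (th + 2 * h)).
  by near: t.
(* [expR A] bounds the full moment from below. Each of the two discarded parts is at most
   [expR A * q] with [q <= 1 / 4], so at least half of [expR A] is left for [p t]. *)
pose A := t * (H (th + h) - k); pose q := expR (- (t * (2 * k))).
have q4 : q <= 1 / 4.
  rewrite /q expRN -[leRHS]invrK lef_pV2 ?posrE ?expR_gt0// ?invr_gt0 ?divr_gt0//.
  apply: le_trans (expR_ge1Dx _).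
  have : 2 / k <= t by near: t; apply: nbhs_pinfty_ge; exact: num_real.
  by rewrite ler_pdivrMr// => ?; lra.
(* Absorbs the factor 1/2 that remains in [b4]. *)
have e2 : 2 <= expR (t * (e / 2)).
  apply: le_trans (expR_ge1Dx _).
  have : 2 / e <= t by near: t; apply: nbhs_pinfty_ge; exact: num_real.
  by rewrite ler_pdivrMr// => ?; lra.
have b1 : expR A <= expR (t * F t (th + h)) by rewrite ler_expR ler_pM2l.
have b2 : expR (t * F t th) <= expR A * q.
  rewrite -expRD ler_expR /A -mulrN -mulrDr ler_pM2l//; lra.
have b3 : expR (- (h * (t * c))) * expR (t * F t (th + 2 * h)) <= expR A * q.
  rewrite -!expRD ler_expR /A.
  have -> : t * (H (th + h) - k) + - (t * (2 * k)) = t * (H (th + h) - k - 2 * k).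
    by ring.
  have -> : - (h * (t * c)) + t * F t (th + 2 * h) = t * (F t (th + 2 * h) - h * c).
    by ring.
  rewrite ler_pM2l//; lra.
have b4 : expR A / 2 <= expR ((th + h) * (t * c)) * p t.
  have := expR_gt0 A; nra.
have {}b4 : expR (A - (th + h) * (t * c)) / 2 <= p t.
  rewrite expRD expRN mulrAC ler_pdivrMr ?expR_gt0// mulrC; lra.
apply: le_trans b4; rewrite ler_pdivlMr// .
apply: (@le_trans _ _ (expR (t * (H th - e)) * expR (t * (e / 2)))).
  by rewrite ler_wpM2l// expR_ge0.
rewrite -expRD ler_expR /A.
have -> : t * (H (th + h) - k) - (th + h) * (t * c) =
  t * (H (th + h) - k - (th + h) * c) by ring.
rewrite -mulrDr ler_pM2l//; lra.
Unshelve. all: by end_near. Qed.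

End rate.

(** * Rounded sample sizes *)

Section sample_size.
Context {R : realType}.

(** The rounding [N] of the theorem; for positive [r] and [t] the ceiling is nonnegative, so the
    absolute value only changes its type. *)
Definition nsamples (r t : R) : nat := `|Num.ceil (r * t)|%N.

Lemma nsamples_bounds (r t : R) : 0 < r -> 0 < t ->
  r * t <= (nsamples r t)%:R <= r * t + 1.
Proof.
move=> r0 t0; have rt0 : 0 < r * t by rewrite mulr_gt0.
have c0 : (0 <= Num.ceil (r * t))%R by rewrite ceil_ge0 (lt_trans _ rt0)// ltrN10.
have -> : (nsamples r t)%:R = (Num.ceil (r * t))%:~R :> R.
  by rewrite /nsamples -[in RHS](gez0_abs c0).
rewrite ceil_ge/=.
by have := ceilB1_lt (r * t); rewrite ?intrB; lra.
Qed.

Lemma cvg_nsamples (r : R) : 0 < r ->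
  (nsamples r t)%:R / t @[t --> +oo] --> r.
Proof.
move=> r0; apply/cvgrPdist_le => e e0; near=> t.
have t0 : 0 < t by near: t; exact: nbhs_pinfty_gt.
have /andP[] := nsamples_bounds r0 t0; set n := (_%:R) => h1 h2.
have te : e^-1 <= t by near: t; apply: nbhs_pinfty_ge; exact: num_real.
rewrite distrC ger0_norm; last by rewrite subr_ge0 ler_pdivlMr.
rewrite lerBlDr ler_pdivrMr// mulrDl (le_trans h2)// addrC lerD2r.
by rewrite -ler_pdivrMl// mulr1.
Unshelve. all: by end_near. Qed.

Lemma nsamples_gt0 (r t : R) : 0 < r -> 0 < t -> 0 < (nsamples r t)%:R :> R.
Proof.
move=> r0 t0; have /andP[h _] := nsamples_bounds r0 t0.
by rewrite (lt_le_trans _ h) ?mulr_gt0.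
Qed.

Lemma cvg_scale_nsamples (s r : R) : 0 < r ->
  s * (t / (nsamples r t)%:R) @[t --> +oo] --> s / r.
Proof.
move=> r0; apply: cvgMr.
have H : ((nsamples r t)%:R / t)^-1 @[t --> +oo] --> r^-1.
  by apply: cvgV; [exact: lt0r_neq0|exact: cvg_nsamples].
suff E : (fun t => ((nsamples r t)%:R / t)^-1) = (fun t => t / (nsamples r t)%:R).
  by rewrite E in H.
by apply/funext => t; rewrite invf_div.
Qed.

Lemma near_scale_nsamples (s r : R) (A : set R) : 0 < r -> nbhs (s / r) A ->
  \forall t \near +oo, A (s * (t / (nsamples r t)%:R)).
Proof. by move=> r0 nA; have /(_ A nA) := @cvg_scale_nsamples s r r0. Qed.

(** With [f] a cumulant function, the left side is the share of one sample mean in log E e^(sZ) / t;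
    the effect of rounding vanishes in the limit. *)
Lemma cvg_nsamplesM (f : R -> R) (s r : R) : 0 < r -> {for s / r, continuous f} ->
  (nsamples r t)%:R / t * f (s * (t / (nsamples r t)%:R)) @[t --> +oo] --> r * f (s / r).
Proof.
move=> r0 cf; apply: cvgM; first exact: cvg_nsamples.
exact: (cvg_comp _ f (@cvg_scale_nsamples s r r0)).
Qed.

End sample_size.

(** * The exponential rate of a single pair *)

Section pair_exponential_rate.
Context {R : realType}.
Variables (Li Lj : R -> \bar R) (mui muj ri rj : R).
Hypotheses (Lic : is_cgf Li mui) (Ljc : is_cgf Lj muj).
Hypotheses (Lir : regular Li) (Ljr : regular Lj).
Hypotheses (ri0 : 0 < ri) (rj0 : 0 < rj).

(** The version of [pair_cgf] at finite [t]: on [pair_dom_at] it is exactly log E e^(sZ) / t, as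
    [mgf_Z] shows. *)
Definition pair_cgf_at (t s : R) : R :=
  (nsamples rj t)%:R / t * real_part Lj (s * (t / (nsamples rj t)%:R)) +
  (nsamples ri t)%:R / t * real_part Li (- s * (t / (nsamples ri t)%:R)).

Definition pair_dom_at (t s : R) : Prop :=
  [/\ 0 < t, eff_dom Lj (s * (t / (nsamples rj t)%:R)) &
     eff_dom Li (- s * (t / (nsamples ri t)%:R))].

Let dom (s : R) : Prop := interior (eff_dom Lj) (s / rj) /\
  interior (eff_dom Li) (- s / ri).

Let near_dom (s : R) : dom s -> \forall t \near +oo, pair_dom_at t s.
Proof.
move=> [dj di].
have Hj := near_scale_nsamples rj0 dj.
have Hi := near_scale_nsamples ri0 di.
have t0 : \forall t \near +oo, (0 : R) < t by exact: nbhs_pinfty_gt.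
apply: filterS3 t0 Hj Hi => t t0 hj hi; exact: And3.
Qed.

Let cvg_at (s : R) : dom s -> pair_cgf_at t s @[t --> +oo] --> pair_cgf Li Lj ri rj s.
Proof.
move=> [dj di]; have [_ dKi _] := Lir; have [_ dKj _] := Ljr.
have cKj : {for s / rj, continuous (real_part Lj)}.
  by apply: differentiable_continuous; apply/derivable1_diffP; exact: dKj.
have cKi : {for - s / ri, continuous (real_part Li)}.
  by apply: differentiable_continuous; apply/derivable1_diffP; exact: dKi.
by apply: cvgD; apply: cvg_nsamplesM.
Qed.

Lemma pair_exponential_rate (p : R -> R) (th : R) : 0 <= th ->
  interior (eff_dom Lj) (th / rj) -> interior (eff_dom Li) (- th / ri) ->
  derive1 (real_part Lj) (th / rj) = derive1 (real_part Li) (- th / ri) ->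
  (forall t s, 0 <= s -> pair_dom_at t s -> p t <= expR (t * pair_cgf_at t s)) ->
  (forall t s h c, 0 <= s -> 0 <= h ->
    pair_dom_at t s -> pair_dom_at t (s - h) -> pair_dom_at t (s + h) ->
    expR (t * pair_cgf_at t s) <= expR (s * (t * c)) * p t +
      expR (t * pair_cgf_at t (s - h)) +
      expR (- (h * (t * c))) * expR (t * pair_cgf_at t (s + h))) ->
  forall e, 0 < e -> \forall t \near +oo,
    expR (t * (pair_cgf Li Lj ri rj th - e)) <= p t <=
    expR (t * (pair_cgf Li Lj ri rj th + e)).
Proof.
move=> th0 Ljth Lith Kth pu pl.
have domth : dom th by split.
apply: (exponential_rate (F := pair_cgf_at) th0).
- exact: (pair_cgf_is_derive0 Lir Ljr ri0 rj0 Ljth Lith Kth).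
- exact: cvg_at.
- by apply: filterS (near_dom domth) => t; exact: pu.
have ndom : \forall h \near (0 : R)^'+, dom (th + h).
  exact: near_pair_dom.
have ndom2 := near_right_scale (ltr0Sn R 1) ndom.
near=> h.
have h0 : 0 < h by near: h; exact: nbhs_right_gt.
have dom1 : dom (th + h) by near: h.
have dom2 : dom (th + 2 * h) by near: h.
split.
- have [dj di] := dom1.
  exact: (pair_cgf_lt Lic Ljc Lir Ljr ri0 rj0 Ljth Lith Kth h0 dj di).
- exact: cvg_at.
- exact: cvg_at.
move=> c c0; apply: filterS3 (near_dom domth) (near_dom dom1) (near_dom dom2).
move=> t d0 d1 d2.
(* With [s = th + h] the neighbours [s - h] and [s + h] are [th] and [th + 2 * h]. *)
have := @pl t (th + h) h c; rewrite addrK -addrA -mulr2n -(mulr_natl h 2); apply => //.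
  by rewrite addr_ge0// ltW.
Unshelve. all: by end_near. Qed.

End pair_exponential_rate.

Section pair_rate.
Context d (T : measurableType d) (R : realType) (P : probability T R) (k : nat).
Variables (X : 'I_k -> nat -> {RV P >-> R}) (mu : 'I_k -> R).
Hypothesis indX : mutually_independent (fun p : 'I_k * nat => X p.1 p.2).
Hypothesis eqX : forall l n (B : set R), measurable B ->
  P (X l n @^-1` B) = P (X l 0%N @^-1` B).
Hypothesis iX : forall l, P.-integrable setT (EFin \o X l 0%N).
Hypothesis EX : forall l, ('E_P[X l 0%N] = (mu l)%:E)%E.

Let L l := log_mgf P (X l 0%N).
Let K l := real_part (L l).

Lemma measurable_sample_mean l n :
  measurable_fun setT (sample_mean (fun q => X l q) n).
Proof.
apply: measurable_funM => //.
apply: measurable_sum => q; exact: measurable_funPT.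
Qed.

Lemma is_cgf_log_mgf l : is_cgf (L l) (mu l).
Proof.
split.
- exact: log_mgfE.
- exact: (log_mgf_convex (iX l) (EX l)).
- exact: log_mgf0.
- exact: (log_mgf_ge (iX l) (EX l)).
Qed.

Variables (a b : 'I_k) (ra rb : R).
Hypotheses (ab : a != b) (ra0 : 0 < ra) (rb0 : 0 < rb).
Hypotheses (Lar : regular (L a)) (Lbr : regular (L b)).

Let Z (t : R) w := t * (sample_mean (fun q => X b q) (nsamples rb t) w -
                  sample_mean (fun q => X a q) (nsamples ra t) w).
(** Each sample of [b] enters [s * Z t] with weight [s * t / n] and each of [a] with the opposite
    sign and its own [n]; independence then factors the integral. *)
Let mgf_Z (t s : R) : pair_dom_at (L a) (L b) ra rb t s ->
  (\int[P]_w (expR (s * Z t w))%:E =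
   (expR (t * pair_cgf_at (L a) (L b) ra rb t s))%:E)%E.
Proof.
move=> [t0 domb doma].
have Na0 := nsamples_gt0 ra0 t0; have Nb0 := nsamples_gt0 rb0 t0.
transitivity (\int[P]_w (expR (
    (s * (t / (nsamples rb t)%:R)) * (\sum_(q < nsamples rb t) X b q w) +
    (- s * (t / (nsamples ra t)%:R)) * (\sum_(q < nsamples ra t) X a q w)))%:E)%E.
  apply: eq_integral => w _; congr (expR _)%:E; rewrite /Z /sample_mean.
  by field; rewrite !gt_eqF.
rewrite integral_expR_samples 1?eq_sym//.
rewrite (log_mgf_lty (iX b) (EX b) domb) (log_mgf_lty (iX a) (EX a) doma).
have e1 x n : ((expR x)%:E ^+ n = (expR (n%:R * x))%:E :> \bar R)%E.
  by rewrite -EFin_expe expRM_natl.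
pose x := real_part (L b) (s * (t / (nsamples rb t)%:R)).
pose y := real_part (L a) (- s * (t / (nsamples ra t)%:R)).
transitivity ((expR ((nsamples rb t)%:R * x))%:E * (expR ((nsamples ra t)%:R * y))%:E)%E.
  by congr (_ * _)%E; exact: e1.
rewrite -EFinM -expRD; congr ((expR _)%:E).
have -> : pair_cgf_at (L a) (L b) ra rb t s =
    (nsamples rb t)%:R / t * x + (nsamples ra t)%:R / t * y by [].
by field; rewrite !gt_eqF.
Qed.

Let p (t : R) : R := fine (P [set w | sample_mean (fun q => X a q) (nsamples ra t) w <=
                            sample_mean (fun q => X b q) (nsamples rb t) w]).

Let p_Z (t : R) : 0 < t -> (p t)%:E = P [set w | 0 <= Z t w].
Proof.
move=> t0; rewrite /p fineK.
  congr (P _); apply/seteqP; split => w /=; rewrite /Z pmulr_rge0// subr_ge0//.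
apply: fin_num_measure; rewrite -[X in measurable X]setTI.
by apply: measurable_fun_le => //; exact: measurable_sample_mean.
Qed.

Lemma pair_rate (th : R) : 0 <= th -> interior (eff_dom (L b)) (th / rb) ->
  interior (eff_dom (L a)) (- th / ra) ->
  derive1 (K b) (th / rb) = derive1 (K a) (- th / ra) ->
  forall e, 0 < e -> \forall t \near +oo,
    expR (t * (pair_cgf (L a) (L b) ra rb th - e)) <= p t <=
    expR (t * (pair_cgf (L a) (L b) ra rb th + e)).
Proof.
move=> th0 Lbth Lath Kth.
have mZ t : measurable_fun setT (Z t).
  apply: measurable_funM; first exact: measurable_cst.
  by apply: measurable_funB; exact: measurable_sample_mean.
apply: (pair_exponential_rate (is_cgf_log_mgf a) (is_cgf_log_mgf b) Lar Lbr
  ra0 rb0 th0 Lbth Lath Kth).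
  move=> t s s0 dom; have [t0 _ _] := dom.
  rewrite -lee_fin (p_Z t0) -(mgf_Z dom).
  exact: (prob_ge0_le_mgf P (mZ t) s0).
move=> t s h c s0 h0 d0 d1 d2; have [t0 _ _] := d0.
have := mgf_le_prob_ge0 P (mZ t) (t * c) s0 h0.
rewrite (mgf_Z d0) (mgf_Z d1) (mgf_Z d2) -(p_Z t0).
by rewrite -!EFinM -!EFinD lee_fin.
Qed.

End pair_rate.

(** * Combining the pairs: union bound, logarithms and the minimum *)

(** The union bound counts all of [I] instead of [D]; a constant factor is harmless on the
    exponential scale. *)
Lemma fin_bigcup_le d (T : measurableType d) (R : realType) (P : {measure set T -> \bar R})
    (I : finType) (D : set I) (A : I -> set T) (c : R) : 0 <= c ->
  (forall i, D i -> measurable (A i)) -> (forall i, D i -> (P (A i) <= c%:E)%E) ->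
  (P (\bigcup_(i in D) A i) <= (#|I|%:R * c)%:E)%E.
Proof.
move=> c0 mA PA; rewrite -{1}(set_mem_set D) bigcup_pred cardE /index_enum -enumT.
elim: (enum I) => [|i s IH]; first by rewrite big_nil measure0 mul0r.
have mU : measurable (\big[setU/set0]_(i <- s | i \in D) A i).
  by apply: bigsetU_measurable => j; rewrite inE; exact: mA.
have sc : (size s)%:R * c <= (size (i :: s))%:R * c by rewrite ler_wpM2r// ler_nat.
rewrite big_cons; case: ifPn => [|_]; last by rewrite (le_trans IH)// lee_fin.
rewrite inE => Di; apply: (le_trans (measureU2 _ (mA _ Di) mU)).
by rewrite /= -natr1 mulrDl mul1r addrC EFinD leeD// PA.
Qed.

(** The constant [C] contributes [ln C / t], which is eventually below [e / 2]; the other half of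
    [e] goes to the exponent. *)
Lemma log_rate (R : realType) (q : R -> R) (g C : R) : 0 < C ->
  (forall e, 0 < e -> \forall t \near +oo,
    expR (t * (- g - e)) <= q t <= C * expR (t * (- g + e))) ->
  - ln (q t) / t @[t --> +oo] --> g.
Proof.
move=> C0 H; apply/cvgrPdist_le => e e0.
have e20 : 0 < e / 2 by rewrite divr_gt0.
near=> t.
have t0 : 0 < t by near: t; exact: nbhs_pinfty_gt.
have /andP[h1 h2] : expR (t * (- g - e / 2)) <= q t <= C * expR (t * (- g + e / 2)).
  by near: t; exact: (H _ e20).
have q0 : 0 < q t by apply: lt_le_trans h1; exact: expR_gt0.
have l1 : t * (- g - e / 2) <= ln (q t) by rewrite -ler_expR lnK.
have l2 : ln (q t) <= ln C + t * (- g + e / 2).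
  by rewrite -ler_expR lnK// expRD lnK.
have Ct : ln C <= t * (e / 2).
  rewrite mulrC -ler_pdivrMl//; near: t; apply: nbhs_pinfty_ge; exact: num_real.
have -> : g - - ln (q t) / t = (t * g + ln (q t)) / t by field; rewrite gt_eqF.
rewrite normrM normfV (gtr0_norm t0) ler_pdivrMr// ler_norml.
have te0 : 0 < t * e by rewrite mulr_gt0.
apply/andP; split; lra.
Unshelve. all: by end_near. Qed.

(** [i1] and [j1] make both ranges nonempty: the minimum over an empty range would be the default
    [+oo], attained by no pair. *)
Lemma bigmin2_attained (R : realType) (I J : finType) (A : pred I) (B : pred J)
    (G : I -> J -> \bar R) (i1 : I) (j1 : J) : A i1 -> B j1 ->
  let V := \big[Order.min/+oo%E]_(i | A i) \big[Order.min/+oo%E]_(j | B j) G i j in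
  (exists i0 j0, [/\ A i0, B j0 & V = G i0 j0]) /\
  (forall i j, A i -> B j -> (V <= G i j)%E).
Proof.
move=> Ai1 Bj1 V; split; last first.
  move=> i j Ai Bj; apply: (le_trans (bigmin_le_cond _ _ Ai)).
  exact: bigmin_le_cond.
have [|i0 Ai0 V0] := eq_bigmin (x := +oo%E) i1 A
  (fun i => \big[Order.min/+oo%E]_(j | B j) G i j) Ai1.
  by move=> i _; exact: leey.
have [|j0 Bj0 W0] := eq_bigmin (x := +oo%E) j1 B (G i0) Bj1.
  by move=> j _; exact: leey.
by exists i0, j0; split => //; rewrite /V V0 W0.
Qed.

Unset Implicit Arguments.

Theorem theorem2 (k m : nat) (hk : (2 <= k)%N) (hm1 : (1 <= m)%N) (hmk : (m < k)%N)
  (d : measure_display) (T : measurableType d) (R : realType)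
  (P : probability T R)
  (X : 'I_k -> nat -> {RV P >-> R}) (mu : 'I_k -> R)
  (sigma : {perm 'I_k})
  (Lam : 'I_k -> R -> \bar R)
  (r : 'I_k -> R) :
  (* all X l n are mutually independent *)
  mutually_independent (fun p : 'I_k * nat => X p.1 p.2) ->
  (* identically distributed within each alternative *)
  (forall l n (B : set R), measurable B ->
      P (X l n @^-1` B) = P (X l 0%N @^-1` B)) ->
  (* alternative l has mean mu l *)
  (forall l, P.-integrable setT (EFin \o X l 0%N) /\ ('E_P[X l 0%N] = (mu l)%:E)%E) ->
  (* sigma i = <i+1>: mu_<1> > mu_<2> > ... > mu_<k> *)
  (forall i j : 'I_k, (i < j)%N -> mu (sigma j) < mu (sigma i)) ->
  (* Assumption 1 *)
  (forall l t,
      ((n%:R)^-1%:E * log_mgf P (sample_mean (fun i => X l i) n) (n%:R * t))%E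
        @[n --> \oo] --> Lam l t) ->
  (* Assumption 2 *)
  (forall l, interior (eff_dom (Lam l)) 0) ->
  (* Assumption 3 *)
  (forall l, forall x y t, interior (eff_dom (Lam l)) x ->
      interior (eff_dom (Lam l)) y -> x != y -> 0 < t < 1 ->
      real_part (Lam l) (t * x + (1 - t) * y) <
        t * real_part (Lam l) x + (1 - t) * real_part (Lam l) y) ->
  (forall l t, interior (eff_dom (Lam l)) t ->
      {for t, continuous (real_part (Lam l))} /\
      derivable (real_part (Lam l)) t 1) ->
  (forall l (u : nat -> R) (b : R),
      (forall n, interior (eff_dom (Lam l)) (u n)) ->
      closure (interior (eff_dom (Lam l))) b ->
      ~ interior (eff_dom (Lam l)) b ->
      u @ \oo --> b ->
      forall M : R, \forall n \near \oo,
        M <= `|derive1 (real_part (Lam l)) (u n)|) ->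
  (* Assumption 4: [mu_<k>, mu_<1>] inside every F_l^o *)
  (forall x : R, (exists i j : 'I_k, mu i <= x <= mu j) ->
      forall l, interior (deriv_range (Lam l)) x) ->
  (* allocations r i = r_<i+1> *)
  (forall i, 0 < r i) -> \sum_(i < k) r i = 1 ->
  let N (i : 'I_k) (t : R) : nat := `|Num.ceil (r i * t)|%N in
  let PFS (t : R) : R :=
    fine (P (\bigcup_(i in [set i : 'I_k | (i < m)%N])
               \bigcup_(j in [set j : 'I_k | (m <= j)%N])
                 [set w | sample_mean (fun n => X (sigma i) n) (N i t) w <=
                          sample_mean (fun n => X (sigma j) n) (N j t) w])) in
  let G (i j : 'I_k) : \bar R :=
    ereal_inf (range (fun x : R =>
      ((r i)%:E * FL_transform (Lam (sigma i)) x +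
       (r j)%:E * FL_transform (Lam (sigma j)) x)%E)) in
  (- ln (PFS t) / t)%:E @[t --> +oo] -->
    \big[Order.min/+oo%E]_(i < k | (i < m)%N)
       \big[Order.min/+oo%E]_(j < k | (m <= j)%N) G i j.
Proof.
move=> indX eqX EX mu_lt limX dom0 sconv deriv _ rangeD r0 _ N PFS G.
have iX l : P.-integrable setT (EFin \o X l 0%N) by have [] := EX l.
have EXmu l : ('E_P[X l 0%N] = (mu l)%:E)%E by have [] := EX l.
have {limX}LamE l : Lam l = log_mgf P (X l 0%N).
  by apply/funext => t; exact: (limit_log_mgf indX eqX (iX l) (EXmu l) (limX l t)).
have Lamr l : regular (Lam l).
  split; [exact: dom0|by move=> t lt; have [] := deriv l t lt|exact: sconv].
have Lamc l : is_cgf (Lam l) (mu l) by rewrite LamE; exact: is_cgf_log_mgf.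
pose A t (i j : 'I_k) := [set w |
  sample_mean (fun n => X (sigma i) n) (N i t) w <=
  sample_mean (fun n => X (sigma j) n) (N j t) w].
have mA t i j : measurable (A t i j).
  rewrite -[X in measurable X]setTI.
  by apply: measurable_fun_le => //; exact: measurable_sample_mean.
have pair (i j : 'I_k) : (i < m)%N -> (m <= j)%N -> exists2 g, G i j = g%:E &
    forall e, 0 < e -> \forall t \near +oo,
      expR (t * (- g - e)) <= fine (P (A t i j)) <= expR (t * (- g + e)).
  move=> im mj.
  have mij : mu (sigma j) < mu (sigma i) by apply: mu_lt; exact: leq_trans im mj.
  have ij : sigma i != sigma j.
    by apply: contraTneq mij => ->; rewrite ltxx.
  (* Assumption 4 at a mean itself, which serves as both ends of the bracket. *)
  have Dj : deriv_range (Lam (sigma j)) (mu (sigma i)).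
    by apply: interior_subset; apply: rangeD; exists (sigma i), (sigma i); rewrite lexx.
  have Di : deriv_range (Lam (sigma i)) (mu (sigma j)).
    by apply: interior_subset; apply: rangeD; exists (sigma j), (sigma j); rewrite lexx.
  have [th [th0 Ljth Lith Kth]] := pair_cgf_critical (Lamc (sigma i))
    (Lamc (sigma j)) (Lamr (sigma i)) (Lamr (sigma j)) (r0 i) (r0 j) mij Dj Di.
  exists (- pair_cgf (Lam (sigma i)) (Lam (sigma j)) (r i) (r j) th).
    exact: (inf_FL_transform (Lamc (sigma i)) (Lamc (sigma j))
      (Lamr (sigma i)) (Lamr (sigma j)) (r0 i) (r0 j) Ljth Lith Kth).
  rewrite opprK.
  have Lri := Lamr (sigma i); have Lrj := Lamr (sigma j).
  move: Ljth Lith Kth Lri Lrj; rewrite (LamE (sigma i)) (LamE (sigma j)).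
  move=> Ljth Lith Kth Lri Lrj.
  exact: (pair_rate indX eqX iX EXmu ij (r0 i) (r0 j) Lri Lrj th0 Ljth Lith Kth).
(* The ordinals 0 and [m] witness that both index ranges are nonempty. *)
have i1m : (Ordinal (leq_trans hm1 (ltnW hmk)) < m)%N by [].
have mj1 : (m <= Ordinal hmk)%N by [].
have [[i0 [j0 [i0m mj0 ->]]] Vmin] :=
  bigmin2_attained (A := fun i : 'I_k => (i < m)%N) (B := fun j : 'I_k => (m <= j)%N)
    G i1m mj1.
have [g0 g0E rate0] := pair i0 j0 i0m mj0.
rewrite g0E in Vmin *.
apply: cvg_EFin; first exact: nearW.
have k0 : (0 : R) < k%:R by rewrite ltr0n (leq_trans _ hk).
(* There are at most [k * k] pairs in the union. *)
apply: (log_rate (C := k%:R * k%:R)); first by rewrite mulr_gt0.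
move=> e e0.
(* Every pair decays at a rate [g >= g0], so the upper bound with [g0] holds for all of them; since
   they are finitely many, it holds from a common [t] on. *)
have H (i j : 'I_k) : \forall t \near +oo, (i < m)%N -> (m <= j)%N ->
    fine (P (A t i j)) <= expR (t * (- g0 + e)).
  have [im|im] := boolP (i < m)%N; last by apply: nearW.
  have [mj|mj] := boolP (m <= j)%N; last by apply: nearW.
  have [g gE rate] := pair i j im mj.
  have gg : g0 <= g by rewrite -lee_fin -gE Vmin.
  apply: filterS2 (nbhs_pinfty_gt (num_real 0)) (rate e e0) => t t0 /andP[_ h] _ _.
  by apply: (le_trans h); rewrite ler_expR ler_pM2l// lerD2r lerN2.
have {}H : \forall t \near +oo, forall i j : 'I_k, (i < m)%N -> (m <= j)%N ->
    fine (P (A t i j)) <= expR (t * (- g0 + e)).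
  by apply: filter_forall => i; apply: filter_forall => j.
apply: filterS2 (rate0 e e0) H => t /andP[h1 _] h2.
have PAE i j : P (A t i j) = (fine (P (A t i j)))%:E.
  by rewrite fineK// fin_num_measure.
pose U i := \bigcup_(j in [set j : 'I_k | (m <= j)%N]) A t i j.
have mU i : measurable (U i) by apply: fin_bigcup_measurable.
have mUU : measurable (\bigcup_(i in [set i : 'I_k | (i < m)%N]) U i).
  exact: fin_bigcup_measurable.
have PFSE : (PFS t)%:E = P (\bigcup_(i in [set i : 'I_k | (i < m)%N]) U i).
  by rewrite fineK// fin_num_measure.
(* From below, the union contains the event of the minimising pair [i0], [j0]; from above, the union
   bound is applied to [j] and then to [i]. *)
apply/andP; split.
  apply: (le_trans h1); rewrite -lee_fin -PAE PFSE; apply: le_measure.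
  - by rewrite inE.
  - by rewrite inE.
  - by move=> w Aw; exists i0 => //; exists j0.
set c := expR _ in h2 *.
have PU (i : 'I_k) : (i < m)%N -> (P (U i) <= (k%:R * c)%:E)%E.
  move=> im; rewrite -(card_ord k).
  apply: (@fin_bigcup_le _ _ _ P _ [set j : 'I_k | (m <= j)%N] (A t i) c).
  - exact: expR_ge0.
  - by move=> j _; exact: mA.
  - by move=> j mj; have := h2 i j im mj; rewrite -lee_fin -PAE.
have c0 : 0 <= k%:R * c by rewrite mulr_ge0 ?expR_ge0// ltW.
have HU := @fin_bigcup_le _ _ _ P _ [set i : 'I_k | (i < m)%N] U _ c0 (fun i _ => mU i) PU.
by rewrite card_ord in HU; rewrite -lee_fin PFSE -mulrA; exact: HU.
Qed.
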